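(* Let $(\mathbf k,\log)$ be an ordered field with surjective logarithm, $(\mathbf k((G)),l)$ a series field with prelogarithmic section, $\psi$ a morphism from $(\mathbf k((G)),l)$ to itself, and $H\ne\{1\}$ a subgroup of $G$. Assume that $H$ satisfies the growth axiom, that $\psi^{EL}$ is surjective, that $(\psi^{EL})^{-1}(H)\subseteq H\cdot\mathrm{Exp}\,\mathbf k((H^{>1}))$, and that $l(H)\subseteq\mathbf k((\psi(H)))$. Then $L_0\subseteq L_1\subseteq L_2\subseteq\cdots$, and the union $LE(H;\psi):=\bigcup_mL_m$ is a subfield of $\mathbf k((G))^{EL}$ containing $\mathbf k((H))$ which is closed under $\mathrm{Exp}$, under $\mathrm{Log}$ (on its positive elements), and under $\psi^{EL}$.
   Context: Let $\mathbf k$ be an ordered field and $(G,\cdot,<)$ a totally ordered abelian group (written multiplicatively). $\mathbf k((G))$ denotes the field of generalized power series $\alpha=\sum_{g\in G}\alpha(g)\,g$ ($\alpha(g)\in\mathbf k$) with anti-well-ordered support, usual operations, canonical valuation $v(\alpha)=\max\operatorname{supp}\alpha$ and ordering $\alpha>0$ iff $\alpha(v(\alpha))>0$; $\mathbf k$, $G$ are identified with subsets of $\mathbf k((G))$. For $S\subseteq G$, $\mathbf k((S))=\{\alpha:\operatorname{supp}\alpha\subseteq S\}$. For a subgroup $H$ and $A\subseteq G$, $H^{>A}=\{h\in H:h>a\ \forall a\in A\}$, $H^{>1}=\{h\in H:h>1\}$. Every $\alpha>0$ is uniquely $\alpha=g\,a(1+\varepsilon)$ with $g=v(\alpha)$,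 $a\in\mathbf k^{>0}$, $\varepsilon\in\mathbf k((G^{<1}))$. A prelogarithmic section is an order-preserving group embedding $l:(G,\cdot)\to(\mathbf k((G^{>1})),+)$; the prelogarithm of $l$ is $L(g\,a(1+\varepsilon))=l(g)+\log a+\sum_{i\ge1}(-1)^{i-1}\varepsilon^i/i$. Exponential extension: $G^\#$ is the ordered abelian group of formal symbols $e(\alpha)$, $\alpha\in\mathbf k((G^{>1}))$, with $e(\alpha)e(\beta)=e(\alpha+\beta)$, $e(\alpha)<e(\beta)\iff\alpha<\beta$, and $e(l(g))$ identified with $g\in G$; $l^\#(e(\alpha))=\alpha$ is a prelogarithmic section of $\mathbf k((G^\#))$ extending $l$. Iterating: $G^{\#n}$, $l^{\#n}$, $L^{\#n}$. The EL-series field is $\mathbf k((G))^{EL}=\bigcup_n\mathbf k((G^{\#n}))$ with $\mathrm{Log}=\bigcup_nL^{\#n}$ and $\mathrm{Exp}=\mathrm{Log}^{-1}$. An order-preserving group embedding $\psi:G\to G$, extended to $\mathbf k((G))$ by $\psi(\sum a_gg)=\sum a_g\psi(g)$, is a morphism of $(\mathbf k((G)),l)$ to itself if $\psi\circ l=l\circ\psi$ on $G$; it induces $\psi^\#=(l^\#)^{-1}\circ\psi\circ l^\#$ on $G^\#$, iterates $\psi^{\#n}$, and $\psi^{EL}=\bigcup_n\psi^{\#n}$. $\psi^{(m)}$ is the $m$-fold composite of $\psi$. A subgroup $H\ne\{1\}$ of $G$ satisfies the growth axiom if $\mathrm{Log}(h)<|f|$ for all $h\in H$ and all nonzero $f\in\mathbf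 k((H^{>1}))$. LE construction: $G^{-1}_m=\{1\}$, $G^0_m=\psi^{(m)}(H)$, $G^{n+1}_m=G^n_m\cdot\mathrm{Exp}\,\mathbf k(((G^n_m)^{>G^{n-1}_m}))\subseteq G^{\#(n+1)}$; $\mathbf k^n_m=\mathbf k((G^n_m))$, $L_m=\bigcup_n\mathbf k^n_m$. *)

(* Defs.v *)
From mathcomp Require Import all_boot all_order all_algebra.
From Stdlib Require Import ClassicalEpsilon.
Require Stdlib.Lists.List Stdlib.Arith.PeanoNat.
Import Order.TTheory GRing.Theory Num.Theory.
Local Open Scope ring_scope.

(* sum of F over the (finite) set P; 0 if P is infinite (never used then) *)
Definition fsum {k : realFieldType} {T : Type} (P : T -> Prop) (F : T -> k) : k :=
  match excluded_middle_informative
          (exists s : list T, List.NoDup s /\ forall x, P x <-> List.In x s) with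
  | left h => let s := proj1_sig (constructive_indefinite_description _ h) in
              \sum_(x <- s) F x
  | right _ => 0
  end.

Definition anti_wo {T : Type} (lt : T -> T -> Prop) (S : T -> Prop) : Prop :=
  forall A : T -> Prop, (forall x, A x -> S x) -> (exists x, A x) ->
    exists m, A m /\ forall y, A y -> ~ lt m y.

Definition is_hahn {k : realFieldType} {T : Type} (lt : T -> T -> Prop) (a : T -> k) :=
  anti_wo lt (fun x => a x <> 0).

Definition ser_pos {k : realFieldType} {T : Type} (lt : T -> T -> Prop) (a : T -> k) :=
  exists m, 0 < a m /\ forall z, a z <> 0 -> z = m \/ lt z m.

Definition ser_lt {k : realFieldType} {T : Type} (lt : T -> T -> Prop) (a b : T -> k) :=
  ser_pos lt (fun x => b x - a x).

Definition mono {k : realFieldType} {T : Type} (x : T) : T -> k :=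
  fun y => if excluded_middle_informative (y = x) then 1 else 0.

Definition push {k : realFieldType} {A B : Type} (f : A -> B) (a : A -> k) : B -> k :=
  fun y => fsum (fun x => f x = y /\ a x <> 0) a.

Record lvl (k : realFieldType) := Lvl {
  car : Type;
  ltl : car -> car -> Prop;
  mull : car -> car -> car;
  onel : car;
  validl : car -> Prop }.
Arguments car {k}. Arguments ltl {k}. Arguments mull {k}.
Arguments onel {k}. Arguments validl {k}.

Definition svalid {k : realFieldType} (L : lvl k) (a : car L -> k) : Prop :=
  is_hahn (ltl L) a /\ forall y, a y <> 0 -> validl L y.

(* L^# = { e(alpha) : alpha in k((L^{>1})) }, group law e(a)e(b)=e(a+b) *)
Definition next {k : realFieldType} (L : lvl k) : lvl k :=
  @Lvl k (car L -> k) (ser_lt (ltl L)) (fun a b x => a x + b x) (fun _ => 0)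
    (fun a => svalid L a /\ forall y, a y <> 0 -> ltl L (onel L) y).

Record ogroup := OGroup {
  gcar :> Type;
  gmul : gcar -> gcar -> gcar;
  gone : gcar;
  glt : gcar -> gcar -> Prop }.

Fixpoint level {k : realFieldType} (O : ogroup) (n : nat) : lvl k :=
  match n with
  | 0 => @Lvl k O (glt O) (gmul O) (gone O) (fun _ => True)
  | S m => next (level O m)
  end.

(* iota n = l^{#n} : G^{#n} -> k((G^{#n,>1})), which is also the identification
   G^{#n} <= G^{#(n+1)} (x = e(l^{#n} x)) and the embedding
   k((G^{#(n-1)})) <= k((G^{#n})) *)
Fixpoint iota {k : realFieldType} (O : ogroup) (l : O -> O -> k) (n : nat)
  : car (@level k O n) -> car (@level k O n.+1) :=
  match n return car (@level k O n) -> car (@level k O n.+1) with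
  | 0 => l
  | S m => push (iota O l m)
  end.

Fixpoint psis {k : realFieldType} (O : ogroup) (psi : O -> O) (n : nat)
  : car (@level k O n) -> car (@level k O n) :=
  match n return car (@level k O n) -> car (@level k O n) with
  | 0 => psi
  | S m => push (psis O psi m)
  end.

Definition smul {k : realFieldType} (L : lvl k) (a b : car L -> k) : car L -> k :=
  fun z => fsum (fun p : car L * car L => mull L p.1 p.2 = z /\ a p.1 <> 0 /\ b p.2 <> 0)
                (fun p => a p.1 * b p.2).

Definition sone {k : realFieldType} (L : lvl k) : car L -> k := mono (onel L).

Definition sinv {k : realFieldType} (L : lvl k) (a : car L -> k) : car L -> k :=
  match excluded_middle_informative (exists b, svalid L b /\ smul L a b = sone L) with
  | left h => proj1_sig (constructive_indefinite_description _ h)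
  | right _ => fun _ => 0
  end.

Definition sexp {k : realFieldType} (L : lvl k) (a : car L -> k) (i : nat) : car L -> k :=
  iter i (smul L a) (sone L).

Definition slead {k : realFieldType} (L : lvl k) (a : car L -> k) : car L :=
  match excluded_middle_informative
          (exists v, a v <> 0 /\ forall z, a z <> 0 -> z = v \/ ltl L z v) with
  | left h => proj1_sig (constructive_indefinite_description _ h)
  | right _ => onel L
  end.

Definition slogsum {k : realFieldType} (L : lvl k) (e : car L -> k) : car L -> k :=
  fun z => fsum (fun i : nat => ((-1) ^+ i / i.+1%:R) * sexp L e i.+1 z <> 0)
                (fun i : nat => ((-1) ^+ i / i.+1%:R) * sexp L e i.+1 z).

(* prelogarithm: L(g a (1+eps)) = l(g) + log a + sum ... *)
Definition slog {k : realFieldType} (L : lvl k) (lL : car L -> car L -> k)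
  (log : k -> k) (a : car L -> k) : car L -> k :=
  let v := slead L a in
  let c := a v in
  let eps := fun z => smul L a (sinv L (fun y => c * mono v y)) z - sone L z in
  fun z => lL v z + log c * sone L z + slogsum L eps z.

(* ---------- the EL-series field k((G))^{EL} = U_n k((G^{#n})) ---------- *)
Definition EL (k : realFieldType) (O : ogroup) := {n : nat & car (@level k O n) -> k}.

(* embed a level-n series at level N (None if N < n) *)
Fixpoint upto {k : realFieldType} (O : ogroup) (l : O -> O -> k) (N n : nat)
  (a : car (@level k O n) -> k) {struct N} : option (car (@level k O N) -> k) :=
  match PeanoNat.Nat.eq_dec n N with
  | left h => Some (eq_rect n (fun j => car (@level k O j) -> k) a N h)
  | right _ =>
      match N return option (car (@level k O N) -> k) with
      | 0 => None
      | S N' => option_map (iota O l N'.+1) (upto O l N' n a)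
      end
  end.


Definition toN {k : realFieldType} {O : ogroup} (l : O -> O -> k) (N : nat) (x : EL k O)
  : car (@level k O N) -> k := odflt (fun _ => 0) (upto O l N (projT1 x) (projT2 x)).

Definition eqEL {k : realFieldType} {O : ogroup} (l : O -> O -> k) (x y : EL k O) : Prop :=
  exists N, upto O l N (projT1 x) (projT2 x) <> None /\
            upto O l N (projT1 x) (projT2 x) = upto O l N (projT1 y) (projT2 y).

Definition validEL {k : realFieldType} {O : ogroup} (x : EL k O) : Prop :=
  svalid (level O (projT1 x)) (projT2 x).

Definition binEL {k : realFieldType} {O : ogroup} (l : O -> O -> k)
  (f : forall N, (car (@level k O N) -> k) -> (car (@level k O N) -> k) -> (car (@level k O N) -> k))
  (x y : EL k O) : EL k O :=
  let N := maxn (projT1 x) (projT1 y) in existT _ N (f N (toN l N x) (toN l N y)).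

Definition addEL {k : realFieldType} {O : ogroup} (l : O -> O -> k) :=
  binEL l (fun N a b z => a z + b z).
Definition mulEL {k : realFieldType} {O : ogroup} (l : O -> O -> k) :=
  binEL l (fun N a b => smul (level O N) a b).
Definition oppEL {k : realFieldType} {O : ogroup} (x : EL k O) : EL k O :=
  existT _ (projT1 x) (fun z => - projT2 x z).
Definition invEL {k : realFieldType} {O : ogroup} (x : EL k O) : EL k O :=
  existT _ (projT1 x) (sinv (level O (projT1 x)) (projT2 x)).
Definition zeroEL {k : realFieldType} {O : ogroup} : EL k O := existT _ 0%N (fun _ => 0).
Definition oneEL {k : realFieldType} {O : ogroup} : EL k O := existT _ 0%N (sone (level O 0%N)).

Definition ltEL {k : realFieldType} {O : ogroup} (l : O -> O -> k) (x y : EL k O) : Prop :=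
  let N := maxn (projT1 x) (projT1 y) in
  ser_pos (ltl (level O N)) (fun z => toN l N y z - toN l N x z).
Definition posEL {k : realFieldType} {O : ogroup} (l : O -> O -> k) (x : EL k O) :=
  ltEL l zeroEL x.
Definition absEL {k : realFieldType} {O : ogroup} (l : O -> O -> k) (x : EL k O) : EL k O :=
  if excluded_middle_informative (posEL l x) then x else oppEL x.

Definition LogEL {k : realFieldType} {O : ogroup} (l : O -> O -> k) (log : k -> k)
  (x : EL k O) : EL k O :=
  existT _ (projT1 x) (slog (level O (projT1 x)) (iota O l (projT1 x)) log (projT2 x)).

Definition ExpEL {k : realFieldType} {O : ogroup} (l : O -> O -> k) (log : k -> k)
  (x : EL k O) : EL k O :=
  match excluded_middle_informative
          (exists y, validEL y /\ posEL l y /\ eqEL l (LogEL l log y) x) with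
  | left h => proj1_sig (constructive_indefinite_description _ h)
  | right _ => x
  end.

(* psi^{EL} = U_n psi^{#n} (acting on k((G^{#n}))) *)
Definition psiEL {k : realFieldType} {O : ogroup} (psi : O -> O) (x : EL k O) : EL k O :=
  existT _ (projT1 x) (psis O psi (projT1 x).+1 (projT2 x)).

Definition monoEL {k : realFieldType} {O : ogroup} (n : nat) (x : car (@level k O n)) : EL k O :=
  existT _ n (mono x).
Definition embG {k : realFieldType} {O : ogroup} (h : O) : EL k O := @monoEL k O 0%N h.

Definition ordered_abelian_group (O : ogroup) : Prop :=
  (forall x y z, gmul O x (gmul O y z) = gmul O (gmul O x y) z) /\
  (forall x y, gmul O x y = gmul O y x) /\
  (forall x, gmul O (gone O) x = x) /\
  (forall x, exists y, gmul O x y = gone O) /\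
  (forall x, ~ glt O x x) /\
  (forall x y z, glt O x y -> glt O y z -> glt O x z) /\
  (forall x y, glt O x y \/ x = y \/ glt O y x) /\
  (forall x y z, glt O x y -> glt O (gmul O x z) (gmul O y z)).

Definition surjective_log {k : realFieldType} (log : k -> k) : Prop :=
  (forall a b, 0 < a -> 0 < b -> log (a * b) = log a + log b) /\
  (forall a b, 0 < a -> a < b -> log a < log b) /\
  (forall y, exists a, 0 < a /\ log a = y).

Definition prelog_section {k : realFieldType} (O : ogroup) (l : O -> O -> k) : Prop :=
  (forall g, svalid (@level k O 0%N) (l g) /\ forall y, l g y <> 0 -> glt O (gone O) y) /\
  (forall g h, l (gmul O g h) = (fun y => l g y + l h y)) /\
  (forall g h, glt O g h -> ser_lt (glt O) (l g) (l h)).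

Definition lmorphism {k : realFieldType} (O : ogroup) (l : O -> O -> k) (psi : O -> O) : Prop :=
  (forall g h, psi (gmul O g h) = gmul O (psi g) (psi h)) /\
  (forall g h, glt O g h -> glt O (psi g) (psi h)) /\
  (forall g, push psi (l g) = l (psi g)).

Definition subgroup (O : ogroup) (H : O -> Prop) : Prop :=
  H (gone O) /\ (forall x y, H x -> H y -> H (gmul O x y)) /\
  (forall x, H x -> exists y, H y /\ gmul O x y = gone O).

Definition in_ser {k : realFieldType} (O : ogroup) (n : nat) (S : car (@level k O n) -> Prop)
  (a : car (@level k O n) -> k) : Prop :=
  svalid (level O n) a /\ forall y, a y <> 0 -> S y.

Definition growth_axiom {k : realFieldType} (O : ogroup) (l : O -> O -> k) (log : k -> k)
  (H : O -> Prop) : Prop :=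
  forall h (f : O -> k), H h -> in_ser O 0%N (fun y => H y /\ glt O (gone O) y) f ->
    (exists y, f y <> 0) ->
    ltEL l (LogEL l log (embG h)) (absEL l (existT _ 0%N f)).

(* Gpair m n = (G^{n-1}_m (embedded in G^{#n}), G^n_m) *)
Fixpoint Gpair {k : realFieldType} (O : ogroup) (l : O -> O -> k) (log : k -> k)
  (psi : O -> O) (H : O -> Prop) (m n : nat)
  : (car (@level k O n) -> Prop) * (car (@level k O n) -> Prop) :=
  match n return (car (@level k O n) -> Prop) * (car (@level k O n) -> Prop) with
  | 0 => (fun x => x = gone O, fun x => exists h, H h /\ x = iter m psi h)
  | S n' =>
      let P := (Gpair O l log psi H m n').1 in
      let Q := (Gpair O l log psi H m n').2 in
      (fun x => exists g, Q g /\ x = iota O l n' g,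
       fun x => exists g f, Q g /\
          in_ser O n' (fun y => Q y /\ forall z, P z -> ltl (level O n') z y) f /\
          eqEL l (monoEL n'.+1 x)
               (mulEL l (monoEL n'.+1 (iota O l n' g)) (ExpEL l log (existT _ n' f))))
  end.

Definition Gnm {k : realFieldType} (O : ogroup) (l : O -> O -> k) (log : k -> k)
  (psi : O -> O) (H : O -> Prop) (m n : nat) : car (@level k O n) -> Prop :=
  (Gpair O l log psi H m n).2.

Definition inL {k : realFieldType} (O : ogroup) (l : O -> O -> k) (log : k -> k)
  (psi : O -> O) (H : O -> Prop) (m : nat) (x : EL k O) : Prop :=
  exists n a, in_ser O n (Gnm O l log psi H m n) a /\ eqEL l x (existT _ n a).

Definition inLE {k : realFieldType} (O : ogroup) (l : O -> O -> k) (log : k -> k)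
  (psi : O -> O) (H : O -> Prop) (x : EL k O) : Prop :=
  exists m, inL O l log psi H m x.

Definition subfieldEL {k : realFieldType} {O : ogroup} (l : O -> O -> k) (S : EL k O -> Prop) :=
  (forall x, S x -> validEL x \/ exists y, validEL y /\ eqEL l x y) /\
  S zeroEL /\ S oneEL /\
  (forall x y, S x -> S y -> S (addEL l x y)) /\
  (forall x, S x -> S (oppEL x)) /\
  (forall x y, S x -> S y -> S (mulEL l x y)) /\
  (forall x, S x -> ~ eqEL l x zeroEL -> S (invEL x)).

(* Main.v *)
From mathcomp Require Import all_boot all_order all_algebra.
From Stdlib Require Import ClassicalEpsilon FunctionalExtensionality PropExtensionality Classical.
Require Stdlib.Lists.List Stdlib.Sorting.Permutation.
Require Import Defs.
Import Order.TTheory GRing.Theory Num.Theory.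
Local Open Scope ring_scope.

(** By the growth axiom, [e(f) > G^n_m] whenever [f > 0] has its support above [G^{n-1}_m], so an
    element of [G^n_m] greater than 1 either exceeds all of [G^{n-1}_m] or belongs to it.
    Splitting exponents accordingly gives [G^{n+1}_m = G^n_m . Exp k((G^n_m)^{>1})].  With this
    description, [H <= psi(H) . Exp k((psi(H))^{>1})] yields [G^n_m <= G^{n+1}_{m+1}] by
    induction on [n], hence [L_m <= L_{m+1}]; [psi^EL] maps [G^n_m] into [G^n_{m+1}]; [Exp] maps
    [k((G^n_m))] into [k((G^{n+1}_m))]; and [l(H) <= k((psi(H)))] sends the logarithms of
    [G^n_m] into [k((G^n_{m+1}))].

    On Hahn series, inverses and preimages under [log(1 + _)] are obtained by well-founded
    recursion on the monoid generated by an anti-well-ordered set of elements below 1, which is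
    anti-well-ordered by Neumann's lemma (here a consequence of Higman's lemma). *)

(** * Finite sums *)

(** An element [e(f)] of [G^{#(n+1)}] is represented by its exponent [f]. The product there is
    addition of series, and [g . Exp f] is the monomial at [l^{#n}(g) + f], so membership in
    [G^{n+1}_m] becomes an additive condition on supports, and no exponential series is ever summed.

    The thresholds of the LE construction are the obstacle to comparing different [m]. The embedding
    of [G^n_m] into [G^{n+1}_{m+1}] raises both indices, so exponents chosen above [G^{n-1}_m] would
    have to lie above [G^n_{m+1}], which they need not do. This is why a description with the fixed
    threshold 1 is wanted.

    The relation between [H] and [psi(H)] comes from the hypotheses on [psi^EL]: an element of [H]
    has a preimage by surjectivity, this preimage lies in [H . Exp k((H^{>1}))], and [psi^EL] is
    applied to its factors.

    An EL-series is a pair of a level and a function, so identities are checked at a common level.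
    This is possible because products, inverses and logarithms commute with pushforward along
    order-preserving group embeddings. *)

Definition fin_pred {T : Type} (P : T -> Prop) :=
  exists s : list T, List.NoDup s /\ forall x, P x <-> List.In x s.

Lemma perm_sum {k : realFieldType} {T : Type} (F : T -> k) (s t : list T) :
  Permutation.Permutation s t -> \sum_(x <- s) F x = \sum_(x <- t) F x.
Proof.
elim=> [|x u v _ IH|x y u|u v w _ -> _ ->] //; first by rewrite !big_cons IH.
by rewrite !big_cons addrCA.
Qed.

Lemma eq_sum_In {k : realFieldType} {T : Type} (F G : T -> k) (s : list T) :
  (forall x, List.In x s -> F x = G x) -> \sum_(x <- s) F x = \sum_(x <- s) G x.
Proof.
elim: s => [|x s IH] h; first by rewrite !big_nil.
by rewrite !big_cons h ?IH //=; [move=> y hy; apply: h; right | left].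
Qed.

Definition decb (P : Prop) : bool := if excluded_middle_informative P then true else false.

Lemma decbP (P : Prop) : reflect P (decb P).
Proof. by rewrite /decb; case: excluded_middle_informative => h; constructor. Qed.

Lemma fin_sub {T : Type} (P : T -> Prop) (s : list T) :
  (forall x, P x -> List.In x s) -> fin_pred P.
Proof.
move=> h; exists (List.filter (fun x => decb (P x))
   (List.nodup (fun x y => excluded_middle_informative (x = y)) s)).
split; first by apply/List.NoDup_filter/List.NoDup_nodup.
move=> x; rewrite List.filter_In List.nodup_In; split.
  by move=> Px; split; [apply: h | apply/decbP].
by case=> _ /decbP.
Qed.

(** Two duplicate-free enumerations of [P] are permutations of each other, so the one picked by
    description is irrelevant. The list may exceed [P] by entries where [F] vanishes, which lets
    several sums share one list. *)
Lemma fsumE {k : realFieldType} {T : Type} (P : T -> Prop) (F : T -> k) (s : list T) :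
  List.NoDup s -> (forall x, P x -> List.In x s) ->
  (forall x, List.In x s -> ~ P x -> F x = 0) -> fsum P F = \sum_(x <- s) F x.
Proof.
move=> us Ps F0; rewrite /fsum; case: excluded_middle_informative; last first.
  by move=> h; case: h; apply: (fin_sub _ _ Ps).
move=> h; case: (constructive_indefinite_description _ h) => t /= [ut tP].
have -> : \sum_(x <- s) F x = \sum_(x <- List.filter (fun x => decb (P x)) s) F x.
  elim: s F0 {us Ps} => [|x s IH] F0; first by rewrite !big_nil.
  have IH' := IH (fun y hy => F0 y (or_intror hy)).
  rewrite big_cons IH' /=; case: decbP => Px; first by rewrite big_cons.
  by rewrite F0 ?add0r //; left.
apply/perm_sum/Permutation.NoDup_Permutation => //; first exact: List.NoDup_filter.
move=> x; rewrite List.filter_In -tP; split; last by case=> _ /decbP.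
by move=> Px; split; [apply: Ps | apply/decbP].
Qed.

Lemma fsum_ext {k : realFieldType} {T : Type} (P Q : T -> Prop) (F G : T -> k) :
  (forall x, P x <-> Q x) -> (forall x, P x -> F x = G x) -> fsum P F = fsum Q G.
Proof.
move=> PQ FG.
have <- : P = Q by apply: functional_extensionality => x; apply: propositional_extensionality.
rewrite /fsum; case: excluded_middle_informative => // h.
case: (constructive_indefinite_description _ h) => t /= [ut tP].
by apply: eq_sum_In => x /tP; apply: FG.
Qed.

Lemma fsum0 {k : realFieldType} {T : Type} (P : T -> Prop) (F : T -> k) :
  (forall x, ~ P x) -> fsum P F = 0.
Proof.
move=> h; rewrite (fsumE P F [::]) ?big_nil //; exact: List.NoDup_nil.
Qed.

Lemma fsum_neq0 {k : realFieldType} {T : Type} (P : T -> Prop) (F : T -> k) :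
  fsum P F <> 0 -> exists x, P x.
Proof. by move=> h; apply: NNPP => nP; apply/h/fsum0 => x Px; apply: nP; exists x. Qed.

Lemma fsum1 {k : realFieldType} {T : Type} (P : T -> Prop) (F : T -> k) (x : T) :
  (forall y, P y -> y = x) -> (~ P x -> F x = 0) -> fsum P F = F x.
Proof.
move=> h F0; rewrite (fsumE P F [:: x]) ?big_cons ?big_nil ?addr0 //.
- by apply: List.NoDup_cons => //; apply: List.NoDup_nil.
- by move=> y /h ->; left.
by move=> y [<-|].
Qed.

Lemma fsum_inj {k : realFieldType} {S T : Type} (h : S -> T) (P : S -> Prop) (Q : T -> Prop)
    (F : S -> k) (G : T -> k) : injective h ->
  (forall y, Q y <-> exists x, P x /\ y = h x) -> (forall x, P x -> G (h x) = F x) ->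
  fsum Q G = fsum P F.
Proof.
move=> hI QP GF.
case: (classic (fin_pred P)) => [[s [us sP]]|nP].
  have map_s : List.NoDup (List.map h s).
    elim: s us {sP} => [|x s IH] us /=; first exact: List.NoDup_nil.
    inversion us; apply: List.NoDup_cons; last exact: IH.
    by move=> /List.in_map_iff [y [/hI ->]].
  rewrite (fsumE P F s) //; [|by move=> x /sP|by move=> x /sP].
  rewrite (fsumE Q G (List.map h s)) //.
  - have -> : \sum_(x <- List.map h s) G x = \sum_(x <- s) G (h x).
      by elim: s {us sP map_s} => [|x s IH]; rewrite ?big_nil //= !big_cons IH.
    by apply: eq_sum_In => x /sP; apply: GF.
  - by move=> y /QP [x [/sP hx ->]]; apply: List.in_map.
  by move=> y /List.in_map_iff [x [<- /sP Px]] []; apply/QP; exists x.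
(* If [P] is infinite, so is [Q], and both sums take the default value 0. *)
have nQ : ~ fin_pred Q.
  case=> t [_ tQ]; apply: nP.
  have [s sP] : exists s, forall x, List.In (h x) t -> List.In x s.
    elim: t {tQ} => [|y t [s IH]]; first by exists [::].
    case: (classic (exists x, h x = y)) => [[x hx]|nx].
      exists (x :: s) => z /= [|/IH]; last by right.
      by rewrite -hx => /hI; left.
    exists s => z /= [hy|/IH //]; by case: nx; exists z.
  by apply: (fin_sub _ s) => x Px; apply: sP; apply/tQ/QP; exists x.
rewrite /fsum.
by case: excluded_middle_informative => // _; case: excluded_middle_informative.
Qed.

Lemma fun_choice {A T : Type} (P : A -> T -> Prop) :
  (forall x, exists y, P x y) -> exists f, forall x, P x (f x).
Proof.
move=> h; exists (fun x => proj1_sig (constructive_indefinite_description _ (h x))) => x.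
exact: (proj2_sig (constructive_indefinite_description _ (h x))).
Qed.

Lemma infinite_seq {T : Type} (P : T -> Prop) : ~ fin_pred P ->
  exists f : nat -> T, (forall n, P (f n)) /\ forall i j, (i < j)%N -> f i <> f j.
Proof.
move=> nP.
have next s : exists x, P x /\ ~ List.In x s.
  apply: NNPP => h; apply: nP; apply: (fin_sub _ s) => x Px.
  by apply: NNPP => nx; apply: h; exists x.
have [c cP] := fun_choice _ next.
pose t := fix t n := if n is m.+1 then c (t m) :: t m else [::].
exists (fun n => c (t n)); split=> [n|i j]; first by case: (cP (t n)).
move=> ij e; case: (cP (t j)) => _; apply; rewrite -e.
elim: j ij {e} => // j IH; rewrite ltnS leq_eqVlt => /orP[/eqP -> | /IH]; by [left|right].
Qed.

Lemma dep_choice {T : Type} (A : T -> Prop) (R : T -> T -> Prop) (x0 : T) : A x0 ->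
  (forall x, A x -> exists y, A y /\ R x y) ->
  exists f : nat -> T, f 0%N = x0 /\ (forall n, A (f n)) /\ forall n, R (f n) (f n.+1).
Proof.
move=> A0 h.
have step x : exists y, A x -> A y /\ R x y.
  case: (classic (A x)) => [/h [y hy]|nA]; first by exists y.
  by exists x => /nA.
have [c cP] := fun_choice _ step.
have Af n : A (iter n c x0) by elim: n => //= n /cP [].
by exists (fun n => iter n c x0); split=> //; split=> // n; case: (cP _ (Af n)).
Qed.

(** * Anti-well-ordered sets and Higman's lemma *)

Section WellQuasiOrder.
Variables (T : Type) (lt : T -> T -> Prop).

Lemma anti_wo_sub (S S' : T -> Prop) :
  (forall x, S x -> S' x) -> anti_wo lt S' -> anti_wo lt S.
Proof. by move=> h w A AS; apply: w => x /AS /h. Qed.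

(** A nonempty set without maximal element yields, by dependent choice, a strictly increasing
    sequence. Transitivity is restricted to [V] because the order of a level is controlled on valid
    elements only. *)
Lemma anti_woP (V S : T -> Prop) :
  (forall x y z, V x -> V y -> V z -> lt x y -> lt y z -> lt x z) ->
  (forall x, S x -> V x) ->
  (forall f : nat -> T, (forall n, S (f n)) -> exists i j, (i < j)%N /\ ~ lt (f i) (f j)) ->
  anti_wo lt S.
Proof.
move=> tr SV good A AS [x0 A0]; apply: NNPP => nm.
have [|f [_ [Af lf]]] := dep_choice A lt x0 A0.
  move=> x Ax; apply: NNPP => h; apply: nm; exists x; split=> // y Ay xy.
  by apply: h; exists y.
have [i [j [ij]]] := good f (fun n => AS _ (Af n)).
apply; elim: j ij => // j IH; rewrite ltnS leq_eqVlt => /orP[/eqP -> //|/IH h].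
by apply: (tr _ (f j)) => //; apply/SV/AS.
Qed.

(** Beyond each position some value of the sequence is maximal among all later ones. Picking its
    index and restarting just after it gives the subsequence. *)
Lemma nonincreasing_subseq (S : T -> Prop) (f : nat -> T) :
  anti_wo lt S -> (forall n, S (f n)) ->
  exists phi : nat -> nat, (forall i j, (i < j)%N -> (phi i < phi j)%N) /\
    forall i j, (i < j)%N -> ~ lt (f (phi i)) (f (phi j)).
Proof.
move=> w fS.
have mx N : exists n, (N <= n)%N /\ forall m, (N <= m)%N -> ~ lt (f n) (f m).
  have [||_ [[n [Nn ->]] h]] := w (fun x => exists n, (N <= n)%N /\ x = f n).
  - by move=> x [n [_ ->]].
  - by exists (f N), N.
  by exists n; split=> // m Nm; apply: h; exists m.
have [g gP] := fun_choice _ mx.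
pose phi := fix phi n := if n is m.+1 then g (phi m).+1 else g 0%N.
have inc i j : (i < j)%N -> (phi i < phi j)%N.
  elim: j => // j IH; have lj : (phi j < phi j.+1)%N by case: (gP (phi j).+1).
  by rewrite ltnS leq_eqVlt => /orP[/eqP -> //|/IH h]; apply: ltn_trans h lj.
exists phi; split=> // i j ij.
case: i ij => [|i] ij /=; first by case: (gP 0%N) => _; apply.
by case: (gP (phi i).+1) => _; apply; apply: inc; apply: ltn_trans ij.
Qed.

(** Higman's subword order for the reversed order of letters: [u] is matched with a subword of [w]
    whose letters are no larger than those of [u]. For letters below 1, passing from [u] to [w] can
    only decrease the product. *)
Inductive emb : list T -> list T -> Prop :=
| emb_nil w : emb [::] w
| emb_skip x u w : emb u w -> emb u (x :: w)
| emb_cons x y u w : ~ lt x y -> emb u w -> emb (x :: u) (y :: w).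

Definition bad (S : T -> Prop) (W : nat -> list T) :=
  (forall n x, List.In x (W n) -> S x) /\ forall i j, (i < j)%N -> ~ emb (W i) (W j).

(* Nash-Williams' minimal bad sequence argument. *)
Lemma higman (S : T -> Prop) (W : nat -> list T) : anti_wo lt S ->
  (forall n x, List.In x (W n) -> S x) ->
  exists i j, (i < j)%N /\ emb (W i) (W j).
Proof.
move=> w WS; apply: NNPP => nW.
have bW : bad S W by split=> // i j ij e; apply: nW; exists i, j.
pose agree n (U U' : nat -> list T) := forall i, (i < n)%N -> U i = U' i.
have step n U : bad S U -> exists U', bad S U' /\ agree n U U' /\
    forall U'', bad S U'' -> agree n U U'' -> (size (U' n) <= size (U'' n))%N.
  move=> bU; apply: NNPP => h.
  (* If no candidate had minimal length at place [n], induction on [s] would bound all these lengths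
     below by every [s]. *)
  suff none s : forall U', bad S U' -> agree n U U' -> (s <= size (U' n))%N.
    by have := none (size (U n)).+1 _ bU (fun _ _ => erefl); rewrite ltnn.
  elim: s => // s IH U' bU' aU'; rewrite ltn_neqAle IH // andbT; apply/eqP => e.
  by apply: h; exists U'; split=> //; split=> // U'' b a; rewrite -e; apply: IH.
pose c n U := match excluded_middle_informative (bad S U) with
  | left h => proj1_sig (constructive_indefinite_description _ (step n U h))
  | right _ => U end.
have cP n U : bad S U -> bad S (c n U) /\ agree n U (c n U) /\
    forall U'', bad S U'' -> agree n U U'' -> (size (c n U n) <= size (U'' n))%N.
  rewrite /c; case: excluded_middle_informative => // h _.
  exact: (proj2_sig (constructive_indefinite_description _ (step n U h))).
pose Us := fix Us n := if n is m.+1 then c m (Us m) else W.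
have bU n : bad S (Us n) by elim: n => //= n /(cP n) [].
have aU m n i : (i < n)%N -> (n <= m)%N -> Us m i = Us n i.
  move=> hi; elim: m => [|m IH]; first by rewrite leqn0 => /eqP e; rewrite e in hi.
  rewrite leq_eqVlt => /orP[/eqP -> //|]; rewrite ltnS => nm.
  case: (cP m _ (bU m)) => _ [a _] /=; rewrite -a ?IH //; exact: leq_trans nm.
(* The diagonal limit: entry [n] is frozen from stage [n.+1] on, so each entry is as short as
   possible given the earlier ones. *)
pose M n := Us n.+1 n.
have MU n i : (i < n)%N -> M i = Us n i by move=> hi; rewrite /M (aU n i.+1 i).
have bM i j : (i < j)%N -> ~ emb (M i) (M j).
  by move=> ij; rewrite (MU j.+1 i) ?(leq_trans ij) // /M; apply: (bU j.+1).2.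
have MS n x : List.In x (M n) -> S x by apply: (bU n.+1).1.
have Mmin n U : bad S U -> agree n M U -> (size (M n) <= size (U n))%N.
  move=> b a; case: (cP n _ (bU n)) => _ [_]; apply=> // i hi.
  by rewrite -a // (MU n).
have Mcons n : exists x u, M n = x :: u.
  case e: (M n) => [|x u]; last by exists x, u.
  case: (bM n n.+1) => //; rewrite e; exact: emb_nil.
have [hd hdP] := fun_choice _ Mcons.
have [tl ME] := fun_choice _ hdP.
have hdS n : S (hd n) by apply: (MS n); rewrite ME; left.
have [phi [phi_lt phi_hd]] := nonincreasing_subseq S hd w hdS.
pose N := phi 0%N.
(* Keep [M] below [N], then continue with the tails of the words selected by [phi]. As their heads
   do not increase, an embedding between two tails would extend to the full words, so [U] is bad;
   but its entry at [N] is shorter than that of [M]. *)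
pose U i := if (i < N)%N then M i else tl (phi (i - N)%N).
have phi_ge i : (N <= phi i)%N.
  by case: i => // i; apply: ltnW; apply: phi_lt.
have bUU : bad S U.
  split=> [n x|i j ij]; rewrite /U.
    case: ifP => _; first exact: MS.
    by move=> hx; apply: (MS (phi (n - N)%N)); rewrite ME; right.
  case: (ltnP j N) => jN; first by rewrite (ltn_trans ij jN); apply: bM.
  case: (ltnP i N) => iN.
    move=> e; apply: (bM i (phi (j - N)%N)); first exact: leq_trans iN _.
    by rewrite (ME (phi _)); apply: emb_skip.
  have lt_ij : (i - N < j - N)%N by rewrite ltn_sub2r // (leq_ltn_trans iN).
  move=> e; apply: (bM _ _ (phi_lt _ _ lt_ij)); rewrite !ME.
  by apply: emb_cons => //; apply: phi_hd.
have := Mmin N U bUU; rewrite /U ltnn subnn -/N ME /= ltnn => /(_ _)/negP.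
by case=> // i ->.
Qed.
End WellQuasiOrder.

(* The group laws hold on the whole carrier, but the order is only known to be total
   on the valid elements. *)
Record good {k : realFieldType} (L : lvl k) : Prop := Good {
  good_mulA : forall x y z, mull L x (mull L y z) = mull L (mull L x y) z;
  good_mulC : forall x y, mull L x y = mull L y x;
  good_mul1 : forall x, mull L (onel L) x = x;
  good_inv : forall x, exists y, mull L x y = onel L;
  good_irr : forall x, ~ ltl L x x;
  good_trans : forall x y z, validl L x -> validl L y -> validl L z ->
    ltl L x y -> ltl L y z -> ltl L x z;
  good_total : forall x y, validl L x -> validl L y -> ltl L x y \/ x = y \/ ltl L y x;
  good_ltM : forall x y z, ltl L x y -> ltl L (mull L x z) (mull L y z);
  good_v1 : validl L (onel L);
  good_vM : forall x y, validl L x -> validl L y -> validl L (mull L x y);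
  good_vV : forall x y, mull L x y = onel L -> validl L x -> validl L y }.

(** * Restrictions, monomials and recursion along anti-well-ordered sets *)

Definition restr {k : realFieldType} {T : Type} (P : T -> Prop) (a : T -> k) : T -> k :=
  fun x => if excluded_middle_informative (P x) then a x else 0.

Lemma restrT {k : realFieldType} {T : Type} (P : T -> Prop) (a : T -> k) x :
  P x -> restr P a x = a x.
Proof. by rewrite /restr; case: excluded_middle_informative. Qed.

Lemma restrF {k : realFieldType} {T : Type} (P : T -> Prop) (a : T -> k) x :
  ~ P x -> restr P a x = 0.
Proof. by rewrite /restr; case: excluded_middle_informative. Qed.

Lemma restr_neq0 {k : realFieldType} {T : Type} (P : T -> Prop) (a : T -> k) x :
  restr P a x <> 0 -> P x /\ a x <> 0.
Proof. by rewrite /restr; case: excluded_middle_informative. Qed.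

Lemma restr0 {k : realFieldType} {T : Type} (P : T -> Prop) (a : T -> k) x :
  a x = 0 -> restr P a x = 0.
Proof. by rewrite /restr; case: excluded_middle_informative. Qed.

Lemma mono_same {k : realFieldType} {T : Type} (x : T) : mono x x = 1 :> k.
Proof. by rewrite /mono; case: excluded_middle_informative. Qed.

Lemma mono_diff {k : realFieldType} {T : Type} (x y : T) : y <> x -> mono x y = 0 :> k.
Proof. by rewrite /mono; case: excluded_middle_informative. Qed.

Lemma mono_neq0 {k : realFieldType} {T : Type} (x y : T) : mono x y <> 0 :> k -> y = x.
Proof. by rewrite /mono; case: excluded_middle_informative. Qed.

Lemma mono_inj {k : realFieldType} {T : Type} (x y : T) : mono x = mono y :> (T -> k) -> x = y.
Proof.
by move=> e; apply: (@mono_neq0 k); rewrite -e mono_same; apply/eqP/oner_neq0.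
Qed.

(** Coefficients are determined from large exponents to small ones: the equation at [z] sees only
    the part of [b] strictly above [z]. Both the inverse of a series and the preimage under
    [log(1 + _)] are obtained in this way. *)
Lemma wf_fix {k : realFieldType} {T : Type} (lt : T -> T -> Prop) (M : T -> Prop)
    (Phi : (T -> k) -> T -> k) : anti_wo lt M ->
  exists b : T -> k, (forall z, ~ M z -> b z = 0) /\
    forall z, M z -> b z = Phi (restr (lt z) b) z.
Proof.
(* In this relation [w] precedes [z] when [w] is the larger exponent. A maximal inaccessible element
   would have only accessible predecessors. *)
move=> w; pose R w z := M w /\ M z /\ lt z w.
have wfR : well_founded R.
  move=> z; apply: NNPP => nz.
  have Mz : M z by apply: NNPP => nM; apply: nz; constructor => y [_ []].
  have [||m [[Mm nm] mx]] := w (fun x => M x /\ ~ Acc R x); first by move=> x [].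
    by exists z.
  apply: nm; constructor => y [My [_ my]]; apply: NNPP => ny.
  exact: (mx y).
pose F z (rec : forall w, R w z -> k) : k :=
  if decb (M z) then
    Phi (fun w => match excluded_middle_informative (R w z) with
                  | left h => rec w h | right _ => 0 end) z
  else 0.
pose b := Fix wfR (fun _ => k) F.
have bE z : b z = F z (fun w _ => b w).
  apply: (Fix_eq wfR (fun _ => k) F) => x f g fg; rewrite /F.
  case: decbP => // _; apply: (f_equal (Phi^~ x)).
  by apply: functional_extensionality => y; case: (excluded_middle_informative (R y x)).
have b0 z : ~ M z -> b z = 0 by rewrite bE /F; case: decbP.
exists b; split=> // z Mz; rewrite bE /F; case: decbP => // _.
apply: (f_equal (Phi^~ z)); apply: functional_extensionality => y.
case: excluded_middle_informative => [[_ [_ zy]]|nR]; first by rewrite restrT.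
case: (classic (lt z y)) => zy; last by rewrite restrF.
by rewrite restrT // b0 // => My; apply: nR.
Qed.

Lemma uniq_NoDup (s : seq nat) : uniq s -> List.NoDup s.
Proof.
elim: s => [|x s IH] /=; first by move=> _; apply: List.NoDup_nil.
case/andP => nx /IH; apply: List.NoDup_cons => hx; case/negP: nx.
elim: s hx {IH} => //= y s IH [->|/IH]; rewrite in_cons ?eqxx // => ->; exact: orbT.
Qed.

Lemma In_iota (n m i : nat) : List.In i (seq.iota m n) <-> (m <= i < m + n)%N.
Proof.
elim: n m => [|n IH] m /=.
  by rewrite addn0; split=> // /andP[a /(leq_ltn_trans a)]; rewrite ltnn.
rewrite IH addSnnS; split.
  case=> [<-|/andP[a ->]]; first by rewrite leqnn addnS ltnS leq_addr.
  by rewrite ltnW.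
by case/andP; rewrite leq_eqVlt => /orP[/eqP ->|-> ->]; [left|right].
Qed.

(** * Hahn series over an ordered abelian group *)

Section Hahn.
Context {k : realFieldType} {L : lvl k}.
Hypothesis G : good L.
Local Notation T := (car L).
Local Notation V := (validl L).
Local Notation "x ** y" := (mull L x y) (at level 40, left associativity).
Local Notation "x <! y" := (ltl L x y) (at level 70).
Local Notation one := (onel L).
Local Notation ser := (T -> k).
Local Notation gmulA := (good_mulA L G).
Local Notation gmulC := (good_mulC L G).
Local Notation gmul1 := (good_mul1 L G).
Local Notation girr := (good_irr L G).
Local Notation gtrans := (good_trans L G).
Local Notation gtotal := (good_total L G).
Local Notation gltM := (good_ltM L G).
Local Notation gv1 := (good_v1 L G).
Local Notation gvM := (good_vM L G).
Local Notation gvV := (good_vV L G).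

Definition gi (x : T) : T := proj1_sig (constructive_indefinite_description _ (good_inv L G x)).

Lemma mulgi x : x ** gi x = one.
Proof. exact: (proj2_sig (constructive_indefinite_description _ (good_inv L G x))). Qed.
Lemma mulgx1 x : x ** one = x.
Proof. by rewrite gmulC gmul1. Qed.
Lemma mulgiK x y : gi x ** (x ** y) = y.
Proof. by rewrite gmulA (gmulC (gi x)) mulgi gmul1. Qed.
Lemma mulKgi x y : x ** (gi x ** y) = y.
Proof. by rewrite gmulA mulgi gmul1. Qed.
Lemma mulg_inj x y z : x ** y = x ** z -> y = z.
Proof. by move=> e; rewrite -(mulgiK x y) e mulgiK. Qed.
Lemma valid_gi x : V x -> V (gi x).
Proof. exact: gvV (mulgi x). Qed.

Definition leg x y := x = y \/ x <! y.

Lemma nlt_leg x y : V x -> V y -> ~ x <! y -> leg y x.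
Proof. by move=> vx vy nxy; case: (gtotal x y vx vy) => [//|[->|]]; [left|right]. Qed.
Lemma leg_nlt x y : V x -> V y -> leg y x -> ~ x <! y.
Proof.
move=> vx vy [->|yx] xy; first exact: girr xy.
exact: (girr x (gtrans _ _ _ vx vy vx xy yx)).
Qed.
Lemma lt_legW x y z : V x -> V y -> V z -> x <! y -> leg y z -> x <! z.
Proof. by move=> vx vy vz xy [<-//|]; apply: gtrans xy. Qed.
Lemma leg_ltW x y z : V x -> V y -> V z -> leg x y -> y <! z -> x <! z.
Proof. by move=> vx vy vz [->//|]; apply: gtrans. Qed.
Lemma leg_trans x y z : V x -> V y -> V z -> leg x y -> leg y z -> leg x z.
Proof. by move=> vx vy vz [->//|xy] yz; right; apply: lt_legW xy yz. Qed.
Lemma ltgM2l x y z : x <! y -> z ** x <! z ** y.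
Proof. by move=> h; rewrite !(gmulC z); apply: gltM. Qed.
Lemma legM x x' y y' : V x -> V x' -> V y -> V y' ->
  leg x x' -> leg y y' -> leg (x ** y) (x' ** y').
Proof.
move=> vx vx' vy vy' [->|xx'] [->|yy']; [by left|right; exact: ltgM2l|right; exact: gltM|].
right; apply: (gtrans _ (x' ** y)); do ?exact: gvM.
  exact: gltM.
exact: ltgM2l.
Qed.
Lemma lt_legM x x' y y' : V x -> V x' -> V y -> V y' ->
  x <! x' -> leg y y' -> x ** y <! x' ** y'.
Proof.
move=> vx vx' vy vy' xx' [->|yy']; first exact: gltM.
apply: (gtrans _ (x' ** y)); do ?exact: gvM.
  exact: gltM.
exact: ltgM2l.
Qed.
Lemma mulg_lt1 x y : x <! one -> x ** y <! y.
Proof. by move=> h; rewrite -{2}(gmul1 y); apply: gltM. Qed.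
Lemma mulg_lt1r x y : y <! one -> x ** y <! x.
Proof. by rewrite gmulC; apply: mulg_lt1. Qed.

(** Given a sequence of products, extract a subsequence along which neither factor increases; then
    the products do not increase either. *)
Lemma anti_wo_mul (A B : T -> Prop) :
  (forall x, A x -> V x) -> (forall x, B x -> V x) ->
  anti_wo (ltl L) A -> anti_wo (ltl L) B ->
  anti_wo (ltl L) (fun z => exists x y, A x /\ B y /\ z = x ** y).
Proof.
move=> AV BV wA wB; apply: (anti_woP _ _ V); first exact: gtrans.
  by move=> z [x [y [/AV vx [/BV vy ->]]]]; apply: gvM.
move=> f /fun_choice [a /fun_choice [b abP]].
have [phi [phi_lt phi_a]] := nonincreasing_subseq _ _ _ a wA (fun n => (abP n).1).
have [psi [psi_lt psi_b]] := nonincreasing_subseq _ _ _ (b \o phi) wB (fun n => (abP _).2.1).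
exists (phi (psi 0%N)), (phi (psi 1%N)); split; first exact/phi_lt/psi_lt.
have va n : V (a n) by apply/AV/(abP n).1.
have vb n : V (b n) by apply/BV/(abP n).2.1.
rewrite !(abP _).2.2; apply: leg_nlt; do ?exact: gvM.
by apply: legM => //; apply: nlt_leg => //; [apply/phi_a/psi_lt | apply: psi_b].
Qed.

(** Infinitely many factorizations would contain two distinct ones in which neither factor
    increases. As the products are both [z], the two would have to coincide. *)
Lemma fin_mul (A B : T -> Prop) z :
  (forall x, A x -> V x) -> (forall x, B x -> V x) ->
  anti_wo (ltl L) A -> anti_wo (ltl L) B ->
  fin_pred (fun p : T * T => p.1 ** p.2 = z /\ A p.1 /\ B p.2).
Proof.
move=> AV BV wA wB; apply: NNPP => /infinite_seq [f [fP fI]].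
have va n : V (f n).1 by apply/AV/(fP n).2.1.
have vb n : V (f n).2 by apply/BV/(fP n).2.2.
have [phi [phi_lt phi_a]] :=
  nonincreasing_subseq _ _ _ (fun n => (f n).1) wA (fun n => (fP n).2.1).
have [psi [psi_lt psi_b]] :=
  nonincreasing_subseq _ _ _ (fun n => (f (phi n)).2) wB (fun n => (fP _).2.2).
set i := phi (psi 0%N); set j := phi (psi 1%N).
have ij : (i < j)%N by apply/phi_lt/psi_lt.
apply: (fI i j ij).
have eqz : (f i).1 ** (f i).2 = (f j).1 ** (f j).2 by rewrite (fP i).1 (fP j).1.
have l2 : leg (f j).2 (f i).2 by apply: nlt_leg => //; apply: psi_b.
have e1 : (f i).1 = (f j).1.
  case: (nlt_leg (f i).1 (f j).1) => // [|l1]; first exact/phi_a/psi_lt.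
  have := lt_legM _ _ _ _ (va j) (va i) (vb j) (vb i) l1 l2.
  by rewrite eqz => /(girr).
have e2 : (f i).2 = (f j).2 by move: eqz; rewrite e1 => /mulg_inj.
by rewrite (surjective_pairing (f i)) e1 e2 -surjective_pairing.
Qed.

(** * Products of words and Neumann's lemma *)

Definition prodl (w : list T) : T := foldr (mull L) one w.
Definition over (S : T -> Prop) (w : list T) := forall x, List.In x w -> S x.

Definition monoid (S : T -> Prop) (z : T) := exists w, over S w /\ z = prodl w.

Section Neumann.
Variable S : T -> Prop.
Hypothesis SV : forall x, S x -> V x.
Hypothesis S1 : forall x, S x -> x <! one.

Lemma over_cons x w : over S (x :: w) -> S x /\ over S w.
Proof. by move=> h; split=> [|y hy]; apply: h; [left|right]. Qed.

Lemma valid_prodl w : over S w -> V (prodl w).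
Proof.
elim: w => [|x w IH] h; first exact: gv1.
by case/over_cons: h => /SV vx /IH; apply: gvM.
Qed.

Lemma prodl_lt1 x w : over S (x :: w) -> prodl (x :: w) <! one.
Proof.
elim: w x => [|y w IH] x oxw; have [Sx ow] := over_cons _ _ oxw.
  by rewrite /= mulgx1; apply: S1.
apply: (gtrans _ (prodl (y :: w))); try exact: gv1.
- exact: valid_prodl.
- exact: valid_prodl.
- exact/mulg_lt1/S1.
exact: IH.
Qed.

(** Every skipped letter is below 1 and makes the product strictly smaller, while matched letters
    never increase it. Recording the lengths separates the strict case, on which the bound on word
    lengths rests. *)
Lemma emb_prodl u w : emb T (ltl L) u w -> over S u -> over S w ->
  size u = size w /\ leg (prodl w) (prodl u) \/
  (size u < size w)%N /\ prodl w <! prodl u.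
Proof.
elim=> {u w} [w|x u w _ IH|x y u w nxy _ IH].
- case: w => [|x w] _ ow; first by left; split=> //; left.
  by right; split=> //; apply: prodl_lt1.
- move=> ou /over_cons [Sx ow]; right.
  have lx : prodl (x :: w) <! prodl w by apply/mulg_lt1/S1.
  have vu := valid_prodl _ ou; have vw := valid_prodl _ ow.
  have vx : V (prodl (x :: w)) by apply: gvM => //; apply: SV.
  case: (IH ou ow) => [[-> h]|[h1 h2]]; split=> //=; [exact: lt_legW h|exact: ltnW|].
  exact: gtrans h2.
move=> /over_cons [Sx ou] /over_cons [Sy ow].
have vu := valid_prodl _ ou; have vw := valid_prodl _ ow.
have yx : leg y x by apply: nlt_leg => //; apply: SV.
case: (IH ou ow) => [[e h]|[h1 h2]]; [left|right]; split=> //=.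
- by rewrite e.
- by apply: legM => //; apply: SV.
by rewrite !(gmulC _ (prodl _)); apply: lt_legM => //; apply: SV.
Qed.

Hypothesis wS : anti_wo (ltl L) S.

Lemma anti_wo_monoid : anti_wo (ltl L) (monoid S).
Proof.
apply: (anti_woP _ _ V); first exact: gtrans.
  by move=> z [w [ow ->]]; apply: valid_prodl.
move=> f /fun_choice [W WP].
have [i [j [ij e]]] := higman _ _ S W wS (fun n => (WP n).1).
exists i, j; split=> //; rewrite (WP i).2 (WP j).2.
have oi := (WP i).1; have oj := (WP j).1.
apply: leg_nlt; do ?exact: valid_prodl.
by case: (emb_prodl _ _ e oi oj) => [[]|[_ h]] //; right.
Qed.

(** Otherwise words of strictly growing length would all have the product [z]. Higman's lemma embeds
    one of them in a longer one, which gives [z < z]. This bound makes the logarithm series a finite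
    sum at each exponent. *)
Lemma monoid_size_bound z : exists N, forall w, over S w -> prodl w = z -> (size w <= N)%N.
Proof.
apply: NNPP => h.
have h' N : exists w, (over S w /\ prodl w = z) /\ (N < size w)%N.
  apply: NNPP => nw; apply: h; exists N => w ow ew; rewrite leqNgt; apply/negP => lw.
  by apply: nw; exists w.
have [w0 [w0P _]] := h' 0%N.
have [|W [_ [WP WS]]] := dep_choice (fun w => over S w /\ prodl w = z)
    (fun u w => (size u < size w)%N) w0 w0P.
  by move=> w _; apply: h'.
have [i [j [ij e]]] := higman _ _ S W wS (fun n => (WP n).1).
have lij : (size (W i) < size (W j))%N.
  elim: j ij {e} => // j IH; rewrite ltnS leq_eqVlt => /orP[/eqP -> //|/IH lj].
  exact: ltn_trans lj _.
case: (emb_prodl _ _ e (WP i).1 (WP j).1) => [[es _]|[_]].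
  by rewrite es ltnn in lij.
by rewrite (WP i).2 (WP j).2 => /(girr).
Qed.
End Neumann.

(** * Valid series and their leading exponents *)

Lemma svalid_union (a b c : ser) : svalid L a -> svalid L b ->
  (forall x, c x <> 0 -> a x <> 0 \/ b x <> 0) -> svalid L c.
Proof.
move=> [wa va] [wb vb] h; split; last by move=> y /h [/va|/vb].
move=> A Ac [x0 Ax0].
have vA x : A x -> V x by move=> /Ac /h [/va|/vb].
case: (classic (exists x, A x /\ a x <> 0)) => [ea|na]; last first.
  apply: wb; last by exists x0.
  by move=> x Ax; case: (h _ (Ac _ Ax)) => // ax; case: na; exists x.
case: (classic (exists x, A x /\ b x <> 0)) => [eb|nb]; last first.
  apply: wa; last by exists x0.
  by move=> x Ax; case: (h _ (Ac _ Ax)) => // bx; case: nb; exists x.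
have [|ma [[Ama ama] mxa]] := wa (fun x => A x /\ a x <> 0) _ ea; first by move=> x [].
have [|mb [[Amb bmb] mxb]] := wb (fun x => A x /\ b x <> 0) _ eb; first by move=> x [].
have vma := vA _ Ama; have vmb := vA _ Amb.
have lea y : A y -> a y <> 0 -> leg y ma.
  by move=> Ay ay; apply: nlt_leg => //; [apply: vA|apply: mxa].
have leb y : A y -> b y <> 0 -> leg y mb.
  by move=> Ay ay; apply: nlt_leg => //; [apply: vA|apply: mxb].
have key m : A m -> leg ma m -> leg mb m -> exists m, A m /\ forall y, A y -> ~ m <! y.
  move=> Am am bm; exists m; split=> // y Ay; have vy := vA _ Ay; have vm := vA _ Am.
  apply: leg_nlt => //.
  case: (h _ (Ac _ Ay)) => [/(lea _ Ay)|/(leb _ Ay)] hy; exact: leg_trans hy _.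
case: (gtotal ma mb vma vmb) => [|[|]] hab.
- by apply: (key mb) => //; [right|left].
- by apply: (key mb) => //; [left|left].
by apply: (key ma) => //; [left|right].
Qed.

Lemma svalid_sub (a c : ser) : svalid L a -> (forall x, c x <> 0 -> a x <> 0) -> svalid L c.
Proof. by move=> va h; apply: (svalid_union a a) => // x /h; left. Qed.

Lemma svalid_restr (P : T -> Prop) (a : ser) : svalid L a -> svalid L (restr P a).
Proof. by move=> va; apply: (svalid_sub a) => // x h; have [] := restr_neq0 _ _ _ h. Qed.

Lemma svalid0 : svalid L (fun _ => 0).
Proof. by split=> // A h [x /h]. Qed.

Lemma add_neq0 (x y : k) : x + y <> 0 -> x <> 0 \/ y <> 0.
Proof. by move=> h; case: (x =P 0) => hx; [right=> hy; apply: h; rewrite hx hy addr0|left]. Qed.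

Lemma mul_neq0 (x y : k) : x * y <> 0 <-> x <> 0 /\ y <> 0.
Proof.
split=> [h|[/eqP hx /eqP hy]]; last by apply/eqP; rewrite mulf_neq0.
by split=> e; apply: h; rewrite e ?mul0r ?mulr0.
Qed.

Lemma svalid_add (a b : ser) : svalid L a -> svalid L b -> svalid L (fun x => a x + b x).
Proof. by move=> va vb; apply: (svalid_union a b) => // x; apply: add_neq0. Qed.

Lemma svalid_mono x : V x -> svalid L (mono x).
Proof.
move=> vx; split; last by move=> y h; rewrite (mono_neq0 _ _ h).
move=> A h [y Ay]; exists y; split=> // z Az.
by rewrite (mono_neq0 _ _ (h _ Ay)) (mono_neq0 _ _ (h _ Az)); apply: girr.
Qed.

Lemma svalid_mulset (a b c : ser) : svalid L a -> svalid L b ->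
  (forall z, c z <> 0 -> exists x y, a x <> 0 /\ b y <> 0 /\ z = x ** y) -> svalid L c.
Proof.
move=> [wa va] [wb vb] h; split; last first.
  by move=> z /h [x [y [/va vx [/vb vy ->]]]]; apply: gvM.
exact: anti_wo_sub (anti_wo_mul _ _ va vb wa wb).
Qed.

Definition is_lead (a : ser) v := a v <> 0 /\ forall z, a z <> 0 -> leg z v.

Lemma lead_exists (a : ser) : svalid L a -> (exists x, a x <> 0) -> exists v, is_lead a v.
Proof.
move=> [wa va] ex; have [//|v [av mx]] := wa _ _ ex.
by exists v; split=> // z az; apply: nlt_leg; [exact: va|exact: va|exact: mx].
Qed.

Lemma lead_unique (a : ser) v w : svalid L a -> is_lead a v -> is_lead a w -> v = w.
Proof.
move=> [_ va] [av hv] [aw hw]; case: (hw _ av) => // vw.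
by case: (leg_nlt v w (va _ av) (va _ aw) (hv _ aw)).
Qed.

Lemma slead_eq (a : ser) v : svalid L a -> is_lead a v -> slead L a = v.
Proof.
move=> va lv; rewrite /slead; case: excluded_middle_informative => [h|[]]; last by exists v.
by case: (constructive_indefinite_description _ h) => w /= lw; apply: (lead_unique a).
Qed.

(** The support of [a - b] has a maximum. Injectivity of multiplication and of the logarithm series
    is decided by comparing coefficients at or from this exponent. *)
Lemma max_diff (a b : ser) : svalid L a -> svalid L b -> a <> b ->
  exists z, V z /\ a z <> b z /\ forall w, z <! w -> a w = b w.
Proof.
move=> va vb ab; pose c x := a x - b x.
have [wc vc] : svalid L c.
  apply: (svalid_union a b) => // x h; apply: NNPP => /not_or_and [/NNPP ha /NNPP hb].
  by apply: h; rewrite /c ha hb subrr.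
have cE x : c x <> 0 <-> a x <> b x.
  by split=> h e; apply: h; [rewrite /c e subrr | apply/eqP; rewrite -subr_eq0; apply/eqP].
have [//||z [cz mx]] := wc (fun x => c x <> 0).
  apply: NNPP => nc; apply: ab; apply: functional_extensionality => x.
  by apply: NNPP => /cE cx; apply: nc; exists x.
exists z; split; first exact: vc.
by split=> [|w zw]; [apply/cE | apply: NNPP => /cE cw; apply: (mx w)].
Qed.

(** * Multiplication of series *)

Lemma smul_neq0 (a b : ser) z : smul L a b z <> 0 ->
  exists x y, a x <> 0 /\ b y <> 0 /\ z = x ** y.
Proof. by move=> /fsum_neq0 [[x y] /= [<- [ax yb]]]; exists x, y. Qed.

Lemma svalid_smul (a b : ser) : svalid L a -> svalid L b -> svalid L (smul L a b).
Proof. by move=> va vb; apply: (svalid_mulset a b) => // z /smul_neq0. Qed.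

Lemma smul_agree (a b a' b' : ser) z :
  (forall x y, x ** y = z -> a x * b y = a' x * b' y) -> smul L a b z = smul L a' b' z.
Proof.
move=> h; apply: fsum_ext => [[x y] /=|[x y] /= [/h ->]] //.
by split=> [[e /mul_neq0 n]|[e /mul_neq0 n]]; split=> //; apply/mul_neq0; rewrite ?h // -?h.
Qed.

(** One finite list of factor pairs serves all series supported within [a] and [b], so that an
    identity between convolutions becomes one between sums over the same list. *)
Lemma smulE (a b : ser) z : svalid L a -> svalid L b -> exists s : list (T * T),
  List.NoDup s /\ (forall p, List.In p s -> p.1 ** p.2 = z) /\
  forall a' b' : ser, (forall x, a' x <> 0 -> a x <> 0) -> (forall x, b' x <> 0 -> b x <> 0) ->
    smul L a' b' z = \sum_(p <- s) a' p.1 * b' p.2.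
Proof.
move=> [wa va] [wb vb]; have [s [us sP]] := fin_mul _ _ z va vb wa wb.
exists s; split=> //; split=> [p /sP []//|a' b' ha hb].
apply: fsumE => //; first by move=> p [e [/ha h1 /hb h2]]; apply/sP.
move=> p /sP [e _] n; apply: NNPP => /mul_neq0 [h1 h2]; exact: n.
Qed.

Lemma smulDr (a b b' : ser) z : svalid L a -> svalid L b -> svalid L b' ->
  smul L a (fun x => b x + b' x) z = smul L a b z + smul L a b' z.
Proof.
(* [c] is the indicator of the union of the two supports. The support of [b + b'] would not do,
   since terms may cancel there. *)
move=> va vb vb'; pose c x : k := (decb (b x <> 0 \/ b' x <> 0))%:R.
have cP x : b x <> 0 \/ b' x <> 0 -> c x <> 0.
  by rewrite /c => /decbP ->; apply/eqP/oner_neq0.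
have vc : svalid L c.
  by apply: (svalid_union b b') => // x; rewrite /c; case: decbP.
have [s [_ [_ sP]]] := smulE a c z va vc.
rewrite !sP // => [|x h|x h|x /add_neq0 //]; try by apply: cP; auto.
by rewrite -big_split; apply: eq_bigr => p _; rewrite mulrDr.
Qed.

Lemma smul_cmono (a : ser) c v z : smul L a (fun y => c * mono v y) z = c * a (gi v ** z).
Proof.
rewrite /smul (fsum1 _ _ (gi v ** z, v)) /=; first by rewrite mono_same mulr1 mulrC.
  move=> [x y] /= [<- [_ /mul_neq0 [_ h]]].
  by rewrite (mono_neq0 _ _ h) (gmulC x) mulgiK.
move=> n; apply: NNPP => /mul_neq0 [h1 h2]; apply: n.
by rewrite gmulC mulKgi.
Qed.

Lemma smulC (a b : ser) : smul L a b = smul L b a.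
Proof.
apply: functional_extensionality => z.
apply: (fsum_inj (fun p : T * T => (p.2, p.1))) => [[x y] [x' y'] /= [-> ->] //||[x y] _].
  move=> [x y] /=; split.
    by move=> [<- [h1 h2]]; exists (y, x); rewrite /= gmulC.
  by move=> [[x' y'] /= [[<- [h1 h2]] [-> ->]]]; rewrite gmulC.
exact: mulrC.
Qed.

Lemma gi1 : gi one = one.
Proof. by rewrite -[gi one](gmul1) mulgi. Qed.

Lemma smulx1 (a : ser) : smul L a (sone L) = a.
Proof.
apply: functional_extensionality => z.
have -> : sone L = (fun y => 1 * mono one y).
  by apply: functional_extensionality => y; rewrite mul1r.
by rewrite smul_cmono mul1r gi1 gmul1.
Qed.

Lemma sone_neq0 z : sone L z <> 0 -> z = one.
Proof. exact: mono_neq0. Qed.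

Lemma svalid_sone : svalid L (sone L).
Proof. exact/svalid_mono/gv1. Qed.

(** Any pair of factors other than [(v, w)] has a smaller product. It is enough that [v] and [w]
    bound the supports; the coefficients there may be 0. *)
Lemma smul_lead (a b : ser) v w : svalid L a -> svalid L b ->
  (forall x, a x <> 0 -> leg x v) -> (forall x, b x <> 0 -> leg x w) -> V v -> V w ->
  smul L a b (v ** w) = a v * b w.
Proof.
move=> [_ va] [_ vb] av bw vv vw; rewrite /smul (fsum1 _ _ (v, w)) //=.
  move=> [x y] /= [e [ax ay]].
  have ev : x = v.
    case: (av _ ax) => // lx.
    have := lt_legM _ _ _ _ (va _ ax) vv (vb _ ay) vw lx (bw _ ay).
    by rewrite e => /(girr).
  by move: e; rewrite ev => /mulg_inj ->.
by move=> n; apply: NNPP => /mul_neq0 [h1 h2]; apply: n.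
Qed.

(** If [v] leads [a] and [z] is the largest exponent where [b] and [b'] differ, then [a (b' - b)]
    has a nonzero coefficient at [v ** z]. *)
Lemma smul_inj (a b b' : ser) : svalid L a -> svalid L b -> svalid L b' ->
  (exists x, a x <> 0) -> smul L a b = smul L a b' -> b = b'.
Proof.
move=> va vb vb' /(lead_exists _ va) [v [av lv]] e.
apply: NNPP => /(max_diff _ _ vb vb') [z [vz [bz agr]]].
pose d x := b' x - b x.
have vd : svalid L d.
  by apply: svalid_add => //; apply: (svalid_sub b) => // x h e0; apply: h; rewrite e0 oppr0.
have : smul L a (fun x => b x + d x) (v ** z) = smul L a b' (v ** z).
  by congr (smul L a _ _); apply: functional_extensionality => x; rewrite /d addrC subrK.
rewrite smulDr // -e => /eqP; rewrite -subr_eq0 addrAC subrr add0r => /eqP.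
rewrite (smul_lead _ _ v z) //; first last.
- by apply: va.2.
- move=> x dx; apply: nlt_leg => //; first exact: vd.2.
  by move=> /agr ez; apply: dx; rewrite /d ez subrr.
apply/mul_neq0; split=> // /eqP; rewrite subr_eq0 => /eqP e'; exact: bz.
Qed.

Lemma sinv_eq (a b : ser) : svalid L a -> svalid L b -> smul L a b = sone L -> sinv L a = b.
Proof.
move=> va vb ab; rewrite /sinv; case: excluded_middle_informative => [h|[]]; last by exists b.
case: (constructive_indefinite_description _ h) => b' /= [vb' ab'].
apply: (smul_inj a) => //; last by rewrite ab ab'.
have := @mono_same k _ one; rewrite -/(sone L) -ab => e1.
have /smul_neq0 [x [y [ax _]]] : smul L a b one <> 0 by rewrite e1; apply/eqP/oner_neq0.
by exists x.
Qed.

(** * Multiplicative inverses *)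

(** Subgroups of the level. The existence results below are stated for all subgroups [Q] containing
    the support of the data, so that their solutions can later be located in [k((G^n_m))]. *)
Definition sgrp (Q : T -> Prop) := Q one /\ (forall x y, Q x -> Q y -> Q (x ** y)) /\
  (forall x y, x ** y = one -> Q x -> Q y).

Lemma sgrp_prodl Q S w : sgrp Q -> (forall x, S x -> Q x) -> over S w -> Q (prodl w).
Proof.
move=> [Q1 [QM _]] SQ; elim: w => [//|x w IH] h.
by apply: QM; [apply/SQ/h; left | apply: IH => y hy; apply: h; right].
Qed.

(** With [v] leading [a], the coefficient of [a b] at [v ** z] is [a v * b z] plus a term that
    depends only on [b] above [z], so the equation can be solved for [b z]. The support of [b] stays
    in [v^-1] times the monoid generated by the exponents of [v^-1 a] below 1. *)
Lemma inverse_exists (a : ser) : svalid L a -> (exists x, a x <> 0) ->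
  exists b : ser, svalid L b /\ smul L a b = sone L /\
    forall Q, sgrp Q -> (forall x, a x <> 0 -> Q x) -> forall x, b x <> 0 -> Q x.
Proof.
move=> va /(lead_exists _ va) [v [av lv]]; have vv := va.2 _ av.
pose S x := x <! one /\ a (v ** x) <> 0.
have SV x : S x -> V x.
  by move=> [_ /va.2 h]; rewrite -(mulgiK v x); apply: gvM => //; apply: valid_gi.
have S1 x : S x -> x <! one by case.
have wS : anti_wo (ltl L) S.
  have wa' := anti_wo_mul (fun x => x = gi v) (fun x => a x <> 0) _ va.2 _ va.1.
  apply: anti_wo_sub (wa' _ _) => [x [_ ax]|x ->|].
  - by exists (gi v), (v ** x); rewrite mulgiK.
  - exact: valid_gi.
  move=> A h [y Ay]; exists y; split=> // z Az.
  by rewrite (h _ Ay) (h _ Az); apply: girr.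
pose M x := monoid S (v ** x).
have MV x : M x -> V x.
  move=> [w [ow e]]; rewrite -(mulgiK v x) e; apply: gvM (valid_prodl S SV _ ow).
  exact: valid_gi.
have wM : anti_wo (ltl L) M.
  have VM x : monoid S x -> V x by move=> [w [ow ->]]; apply: (valid_prodl S SV).
  have wa' := anti_wo_mul (fun x => x = gi v) (monoid S) _ VM _ (anti_wo_monoid S SV S1 wS).
  apply: anti_wo_sub (wa' _ _) => [x Mx|x ->|].
  - by exists (gi v), (v ** x); rewrite mulgiK.
  - exact: valid_gi.
  move=> A h [y Ay]; exists y; split=> // z Az.
  by rewrite (h _ Ay) (h _ Az); apply: girr.
have [b [b0 bE]] := wf_fix (ltl L) M
  (fun d z => (a v)^-1 * (sone L (v ** z) - smul L a d (v ** z))) wM.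
have Mb x : b x <> 0 -> M x by move=> bx; apply: NNPP => /b0.
have vb : svalid L b.
  split; last by move=> y /Mb /MV.
  exact: anti_wo_sub wM.
exists b; split=> //; split; last first.
  move=> Q gQ aQ x /Mb [w [ow e]]; have [Q1 [QM QV]] := gQ.
  have Qi : Q (gi v) by apply: QV (mulgi v) _; apply: aQ.
  rewrite -(mulgiK v x) e; apply: (QM _ _) => //; apply: (sgrp_prodl Q S) => // y [_ /aQ ay].
  by rewrite -(mulgiK v y); apply: (QM _ _).
apply: functional_extensionality => u; rewrite -(mulKgi v u); set z := gi v ** u.
case: (classic (M z)) => [Mz|nM].
  have vz := MV _ Mz.
  (* [b1] is the part already used by the recursion at [z]. The exponents of [b2] are at most [z],
     so it contributes exactly [a v * b z] at [v ** z]. *)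
  pose b1 := restr (ltl L z) b; pose b2 := restr (fun w => ~ z <! w) b.
  have v1 : svalid L b1 by apply: svalid_restr.
  have v2 : svalid L b2 by apply: svalid_restr.
  have -> : b = (fun x => b1 x + b2 x).
    apply: functional_extensionality => x; rewrite /b1 /b2.
    case: (classic (z <! x)) => zx; first by rewrite restrT // restrF ?addr0 //; auto.
    by rewrite restrF // restrT ?add0r.
  rewrite smulDr // (smul_lead a b2 v z) //; last first.
    by move=> x h; have [nzx /vb.2 vx] := restr_neq0 _ _ _ h; apply: nlt_leg.
  rewrite /b2 restrT; last exact: girr.
  rewrite bE // mulrA mulfV ?mul1r; last exact/eqP.
  by rewrite addrC subrK.
(* Outside [M] both sides vanish: 1 is the empty product, and a term [x ** y] with [y] in [M] is
   [v^-1 x], which is 1 or in [S], times the word for [v ** y]. *)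
have n1 : v ** z <> one by move=> e; apply: nM; exists [::]; split.
have -> : sone L (v ** z) = 0 by apply: mono_diff.
apply: NNPP => /smul_neq0 [x [y [ax [/Mb [w [ow e]] exy]]]]; apply: nM; rewrite /M exy.
have -> : x ** y = (gi v ** x) ** prodl w.
  by rewrite -e [gi v ** x]gmulC -gmulA mulgiK.
case: (lv _ ax) => [->|xv].
  by exists w; split=> //; rewrite gmulC (gmulC (gi v)) mulgi mulgx1.
exists (gi v ** x :: w); split=> // s [<-|/ow //]; split.
  by have := ltgM2l _ _ (gi v) xv; rewrite (gmulC (gi v) v) mulgi.
by rewrite mulKgi.
Qed.

(** * The series [log(1 + e)] for infinitesimal [e] *)

Definition inft (e : ser) := svalid L e /\ forall z, e z <> 0 -> z <! one.

Lemma sexp_words (e : ser) i z : sexp L e i z <> 0 ->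
  exists w, size w = i /\ over (fun x => e x <> 0) w /\ z = prodl w.
Proof.
elim: i z => [|i IH] z; first by move=> /sone_neq0 h; exists [::]; do 2!split.
move=> /smul_neq0 [x [y [ex [/IH [w [<- [ow ->]]] ->]]]].
by exists (x :: w); split=> //; split=> // u [<-|/ow].
Qed.

Lemma svalid_sexp (e : ser) i : svalid L e -> svalid L (sexp L e i).
Proof.
move=> ve; elim: i => [|i IH]; first exact: svalid_sone.
exact: svalid_smul.
Qed.

Lemma sexp_lt1 (e : ser) i z : inft e -> sexp L e i.+1 z <> 0 -> z <! one.
Proof.
move=> [ve e1] /sexp_words [[|x w] [//= _ [ow ->]]].
exact: (prodl_lt1 (fun x => e x <> 0) ve.2 e1).
Qed.

Lemma sexp1 (e : ser) : sexp L e 1 = e.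
Proof. exact: smulx1. Qed.

Lemma sexp_bound (e : ser) z : inft e ->
  exists N, forall i, (N <= i)%N -> sexp L e i.+1 z = 0.
Proof.
move=> [ve e1].
have [N NP] := monoid_size_bound (fun x => e x <> 0) ve.2 e1 ve.1 z.
exists N => i Ni; apply: NNPP => /sexp_words [w [sw [ow ez]]].
by have := NP w ow (esym ez); rewrite sw leqNgt ltnS Ni.
Qed.

(* If [e] and [e'] agree above [z], their powers of exponent at least 2 agree at [z] too,
   since the factors of a product equal to [z] are all greater than [z]. *)
Lemma sexp_agree (e e' : ser) z : inft e -> inft e' -> V z ->
  (forall w, z <! w -> e w = e' w) ->
  forall i w, V w -> leg z w -> sexp L e i.+2 w = sexp L e' i.+2 w.
Proof.
move=> ie ie' vz agr.
have lift i : (forall w, V w -> z <! w -> sexp L e i.+1 w = sexp L e' i.+1 w) ->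
    forall w, V w -> leg z w -> sexp L e i.+2 w = sexp L e' i.+2 w.
  move=> IH w vw zw; apply: smul_agree => x y exy.
  change (e x * sexp L e i.+1 y = e' x * sexp L e' i.+1 y).
  case: (classic (e x = 0 /\ e' x = 0)) => [[-> ->]|nx]; first by rewrite !mul0r.
  case: (classic (sexp L e i.+1 y = 0 /\ sexp L e' i.+1 y = 0)) => [[-> ->]|ny].
    by rewrite !mulr0.
  have [vx x1] : V x /\ x <! one.
    by case: (not_and_or _ _ nx) => h; split;
      [exact: (ie.1.2 _ h)|exact: (ie.2 _ h)|exact: (ie'.1.2 _ h)|exact: (ie'.2 _ h)].
  have [vy y1] : V y /\ y <! one.
    case: (not_and_or _ _ ny) => h; split.
    - exact: ((svalid_sexp e i.+1 ie.1).2 _ h).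
    - exact: sexp_lt1 ie h.
    - exact: ((svalid_sexp e' i.+1 ie'.1).2 _ h).
    - exact: sexp_lt1 ie' h.
  have zx : z <! x.
    by apply: leg_ltW zw _ => //; rewrite -exy; apply: mulg_lt1r.
  have zy : z <! y.
    by apply: leg_ltW zw _ => //; rewrite -exy; apply: mulg_lt1.
  by rewrite agr // IH.
elim=> [|i IH]; apply: lift => w vw zw; first by rewrite !sexp1 agr.
by apply: IH => //; right.
Qed.

Lemma slogsumE (e : ser) z N : (forall i, (N <= i)%N -> sexp L e i.+1 z = 0) ->
  slogsum L e z = \sum_(i < N) ((-1) ^+ i / i.+1%:R) * sexp L e i.+1 z.
Proof.
move=> h; rewrite /slogsum (fsumE _ _ (seq.iota 0 N)).
- rewrite -(big_mkord xpredT (fun i => ((-1) ^+ i / i.+1%:R) * sexp L e i.+1 z)).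
  by rewrite /index_iota subn0.
- exact/uniq_NoDup/iota_uniq.
- move=> i n0; apply/In_iota; rewrite add0n /= ltnNge; apply/negP => /h e0.
  by apply: n0; rewrite e0 mulr0.
by move=> i _ /NNPP.
Qed.

(** What remains of the logarithm series after removing [e] consists of powers of exponent at least
    2, which at [z] depend only on [e] above [z]. Hence the series is injective, and
    [log(1 + d) = e] can be solved recursively. *)
Lemma slogsum_agree (e e' : ser) z : inft e -> inft e' -> V z ->
  (forall w, z <! w -> e w = e' w) ->
  slogsum L e z - e z = slogsum L e' z - e' z.
Proof.
move=> ie ie' vz agr.
have [N NP] := sexp_bound e z ie; have [N' NP'] := sexp_bound e' z ie'.
rewrite (slogsumE e z (maxn N N').+1); last first.
  by move=> i hi; apply: NP; apply: leq_trans (ltnW hi); apply: leq_maxl.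
rewrite (slogsumE e' z (maxn N N').+1); last first.
  by move=> i hi; apply: NP'; apply: leq_trans (ltnW hi); apply: leq_maxr.
(* The bound was taken as a successor so that the term of index 0 is present; it is the series
   itself and cancels. *)
rewrite !big_ord_recl !sexp1 expr0 invr1 !mul1r ![_ + \sum_(i < _) _]addrC !addrK.
apply: eq_bigr => i _; rewrite /= /bump /= add1n; congr (_ * _).
by apply: (sexp_agree e e' z) => //; left.
Qed.

Lemma slogsum_neq0 (e : ser) z : slogsum L e z <> 0 -> exists i, sexp L e i.+1 z <> 0.
Proof. by move=> /fsum_neq0 [i /mul_neq0 [_ h]]; exists i. Qed.

Lemma slogsum_monoid (e : ser) z : slogsum L e z <> 0 -> monoid (fun x => e x <> 0) z.
Proof. by move=> /slogsum_neq0 [i /sexp_words [w [_ h]]]; exists w. Qed.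

Lemma inft_slogsum (e : ser) : inft e -> inft (slogsum L e).
Proof.
move=> ie; have [[we ve] e1] := ie.
split; last by move=> z /slogsum_neq0 [i]; apply: sexp_lt1.
split; last by move=> z /slogsum_neq0 [i]; apply: (svalid_sexp e i.+1 ie.1).2.
apply: anti_wo_sub (anti_wo_monoid _ ve e1 we) => z; exact: slogsum_monoid.
Qed.

Lemma slogsum_inj (e e' : ser) : inft e -> inft e' -> slogsum L e = slogsum L e' -> e = e'.
Proof.
move=> ie ie' eqs; apply: NNPP => /(max_diff _ _ ie.1 ie'.1) [z [vz [nz agr]]]; apply: nz.
by have := slogsum_agree e e' z ie ie' vz agr; rewrite eqs => /addrI /oppr_inj.
Qed.

Lemma slogsum0 : slogsum L (fun _ => 0) = (fun _ => 0).
Proof.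
apply: functional_extensionality => z; apply: NNPP => /slogsum_neq0 [i].
by move=> /smul_neq0 [x [y []]].
Qed.

(** The equation is rewritten as [d = e - (log(1 + d) - d)], whose right side at [z] involves only
    [d] above [z]. *)
Lemma slogsum_surj (e : ser) : inft e -> exists d : ser, inft d /\ slogsum L d = e /\
  forall Q, sgrp Q -> (forall x, e x <> 0 -> Q x) -> forall x, d x <> 0 -> Q x.
Proof.
move=> [[we ve] e1]; pose S x := e x <> 0.
(* The condition [z <! one] removes just the empty product. [M] stays closed under products, and
   series supported in it are infinitesimal. *)
pose M z := monoid S z /\ z <! one.
have MV z : monoid S z -> V z by move=> [w [ow ->]]; apply: (valid_prodl S).
have MS z : S z -> M z.
  move=> Sz; split; last exact: e1.
  by exists [:: z]; rewrite /= mulgx1; split=> // x [<-|].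
have wM : anti_wo (ltl L) M.
  by apply: anti_wo_sub (anti_wo_monoid S ve e1 we) => z [].
have MM x y : M x -> M y -> M (x ** y).
  move=> [Mx x1] [My y1]; have vx := MV _ Mx; have vy := MV _ My.
  split; last first.
    by apply: (gtrans _ y) => //; [exact: gvM|exact: gv1|exact: mulg_lt1].
  case: Mx My => [u [ou ->]] [w [ow ->]].
  exists (u ++ w); split; first by move=> s /List.in_app_iff [/ou|/ow].
  elim: u {ou} => [|s u IH] /=; first exact: gmul1.
  by rewrite -IH gmulA.
have expM (d : ser) i z : (forall x, d x <> 0 -> M x) -> sexp L d i.+1 z <> 0 -> M z.
  move=> dM; elim: i z => [|i IH] z; first by rewrite sexp1; apply: dM.
  by move=> /smul_neq0 [x [y [/dM Mx [/IH My ->]]]]; apply: MM.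
have Minft (d : ser) : (forall x, d x <> 0 -> M x) -> inft d.
  move=> dM; split; last by move=> z /dM [].
  by split; [exact: anti_wo_sub wM|move=> y /dM [/MV]].
have [d [d0 dE]] := wf_fix (ltl L) M (fun d z => e z - (slogsum L d z - d z)) wM.
have dM x : d x <> 0 -> M x by move=> dx; apply: NNPP => /d0.
have id_ := Minft d dM.
exists d; split=> //; split; last first.
  by move=> Q gQ eQ x /dM [[w [ow ->]] _]; apply: (sgrp_prodl Q S).
apply: functional_extensionality => z; case: (classic (M z)) => [Mz|nM].
  have ir : inft (restr (ltl L z) d).
    by apply: Minft => x h; apply: dM; have [] := restr_neq0 _ _ _ h.
  have := slogsum_agree d _ z id_ ir (MV _ Mz.1).
  rewrite -[X in _ = X](subKr (e z)) -dE // => /(_ _)/(canRL (subrK _)) -> => [|w zw].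
    by rewrite subrK.
  by rewrite restrT.
have -> : e z = 0 by apply: NNPP => /MS.
by apply: NNPP => /slogsum_neq0 [i /(expM d i z dM)].
Qed.

(** * The prelogarithm *)

Section Log.
Variables (lL : T -> ser) (log : k -> k).
Hypothesis lL_gt1 : forall v y, V v -> lL v y <> 0 -> one <! y.
Hypothesis logP : surjective_log log.

(** The [epsilon] of the decomposition [a = v c (1 + epsilon)], with [c = a v]. *)
Definition seps (a : ser) (v : T) : ser := fun z => (a v)^-1 * a (v ** z) - sone L z.

Lemma svalid_shift (a : ser) v c : svalid L a -> V v -> svalid L (fun z => c * a (v ** z)).
Proof.
move=> va vv; apply: (svalid_mulset (mono (gi v)) a) => //.
  exact/svalid_mono/valid_gi.
move=> z /mul_neq0 [_ az]; exists (gi v), (v ** z); rewrite mono_same mulgiK.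
by split=> //; apply/eqP/oner_neq0.
Qed.

Lemma svalid_opp (a : ser) : svalid L a -> svalid L (fun x => - a x).
Proof. by move=> va; apply: (svalid_sub a) => // x h e; apply: h; rewrite e oppr0. Qed.

Lemma inft_seps (a : ser) v : svalid L a -> is_lead a v -> inft (seps a v).
Proof.
move=> va [av lv]; have vv := va.2 _ av; split.
  by apply: svalid_add; [exact: svalid_shift|exact/svalid_opp/svalid_sone].
move=> z; rewrite /seps => h.
have n1 : z <> one.
  by move=> ez; apply: h; rewrite ez mulgx1 mulVf /sone ?mono_same ?subrr //; apply/eqP.
move: h; rewrite /sone mono_diff // subr0 => /mul_neq0 [_ /lv [e|]].
  by case: n1; apply: (mulg_inj v); rewrite e mulgx1.
by move=> /(ltgM2l _ _ (gi v)); rewrite mulgiK (gmulC _ v) mulgi.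
Qed.

Lemma sinv_cmono c v : c <> 0 -> V v ->
  sinv L (fun y => c * mono v y) = (fun y => c^-1 * mono (gi v) y).
Proof.
move=> c0 vv; apply: sinv_eq.
- by apply: (svalid_sub (mono v)); [exact: svalid_mono|move=> x /mul_neq0 []].
- by apply: (svalid_sub (mono (gi v))); [exact/svalid_mono/valid_gi|move=> x /mul_neq0 []].
apply: functional_extensionality => z; rewrite smulC smul_cmono.
rewrite /sone; case: (classic (z = one)) => [->|n1].
  by rewrite mulgx1 !mono_same mulr1 mulfV //; apply/eqP.
rewrite !mono_diff ?mulr0 // => e; apply: n1; apply: (mulg_inj (gi v)).
by rewrite e mulgx1.
Qed.

Lemma slogE (a : ser) v : svalid L a -> is_lead a v -> slog L lL log a =
  fun z => lL v z + log (a v) * sone L z + slogsum L (seps a v) z.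
Proof.
move=> va lv; have vv := va.2 _ lv.1; rewrite /slog (slead_eq a v) //.
apply: functional_extensionality => z; congr (_ + slogsum L _ z).
apply: functional_extensionality => y; rewrite sinv_cmono; [|exact: lv.1|by []].
rewrite smul_cmono /seps; congr (_ * a (_ ** _) - _).
by apply: (mulg_inj (gi v)); rewrite mulgi gmulC mulgi.
Qed.

Lemma log1 : log 1 = 0.
Proof.
by have := logP.1 1 1 ltr01 ltr01; rewrite mulr1 => /eqP; rewrite -subr_eq subrr eq_sym => /eqP.
Qed.

Lemma is_lead_mono v : is_lead (mono v) v.
Proof.
split=> [|z h]; first by rewrite mono_same; apply/eqP/oner_neq0.
by left; apply: mono_neq0 h.
Qed.

Lemma slog_mono v : V v -> slog L lL log (mono v) = lL v.
Proof.
move=> vv; rewrite (slogE _ v (svalid_mono _ vv) (is_lead_mono v)).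
have -> : seps (mono v) v = (fun _ => 0).
  apply: functional_extensionality => z; rewrite /seps mono_same invr1 mul1r /sone.
  case: (classic (z = one)) => [->|n1]; first by rewrite mulgx1 !mono_same subrr.
  rewrite !mono_diff ?subrr // => e; apply: n1; apply: (mulg_inj v).
  by rewrite e mulgx1.
apply: functional_extensionality => z.
by rewrite mono_same log1 mul0r addr0 slogsum0 addr0.
Qed.

(** The three summands of the logarithm are supported above 1, at 1 and below 1, so each can be read
    off from the sum. Injectivity and surjectivity of the logarithm are then treated summand by
    summand. *)
Lemma slog_gt1 (a : ser) v z : svalid L a -> is_lead a v ->
  one <! z -> slog L lL log a z = lL v z.
Proof.
move=> va lv z1; rewrite (slogE a v) //.
have -> : sone L z = 0 by apply: mono_diff => e; rewrite e in z1; exact: girr z1.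
have -> : slogsum L (seps a v) z = 0; last by rewrite mulr0 !addr0.
apply: NNPP => h; have [[_ vs] s1] := inft_slogsum _ (inft_seps a v va lv).
by apply: (leg_nlt z one (vs _ h) gv1 _ (s1 _ h)); right.
Qed.

Lemma lL_ngt1 v z : V v -> ~ one <! z -> lL v z = 0.
Proof. by move=> vv nz; apply: NNPP => /(lL_gt1 _ _ vv). Qed.

Lemma slog_one (a : ser) v : svalid L a -> is_lead a v -> slog L lL log a one = log (a v).
Proof.
move=> va lv; rewrite (slogE a v) // lL_ngt1; [|exact: va.2 lv.1|exact: girr].
rewrite /sone mono_same mulr1 add0r.
have -> : slogsum L (seps a v) one = 0; last by rewrite addr0.
apply: NNPP => h; exact: (girr _ ((inft_slogsum _ (inft_seps a v va lv)).2 _ h)).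
Qed.

Lemma log_inj x y : 0 < x -> 0 < y -> log x = log y -> x = y.
Proof.
move=> x0 y0 e; have [_ [lm _]] := logP.
by case: (ltrgtP x y) => // h; [have := lm _ _ x0 h|have := lm _ _ y0 h]; rewrite e ltxx.
Qed.

Lemma slog_inj (a b : ser) v w : (forall x y, V x -> V y -> lL x = lL y -> x = y) ->
  svalid L a -> svalid L b -> is_lead a v -> is_lead b w -> 0 < a v -> 0 < b w ->
  slog L lL log a = slog L lL log b -> a = b.
Proof.
move=> lI va vb lv lw av bw e.
have vv := va.2 _ lv.1; have vw := vb.2 _ lw.1.
have evw : v = w.
  apply: (lI _ _ vv vw); apply: functional_extensionality => z.
  case: (classic (one <! z)) => z1; last by rewrite (lL_ngt1 _ _ vv z1) (lL_ngt1 _ _ vw z1).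
  by rewrite -(slog_gt1 a v z va lv z1) e (slog_gt1 b w z vb lw z1).
rewrite -{w}evw in lw bw vw *.
have ec : a v = b v.
  by apply: (log_inj _ _ av bw); rewrite -(slog_one a v va lv) e (slog_one b v vb lw).
have es : seps a v = seps b v.
  apply: (slogsum_inj _ _ (inft_seps a v va lv) (inft_seps b v vb lw)).
  apply: functional_extensionality => z; have /(f_equal (fun f => f z)) := e.
  by rewrite (slogE a v va lv) (slogE b v vb lw) ec => /addrI.
apply: functional_extensionality => z.
have /(f_equal (fun f => f (gi v ** z))) := es.
rewrite /seps mulKgi ec => /addIr /mulfI; apply.
by rewrite invr_eq0; apply/eqP; apply: lw.1.
Qed.

(** The preimage is [b v (1 + d)], where [log b] is the coefficient of [x] at 1 and [log(1 + d)] its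
    part below 1. That the part above 1 has the form [l(v)] is assumed; it holds once [x] has been
    embedded one level higher. *)
Lemma slog_surj (x : ser) v : svalid L x -> V v -> lL v = restr (ltl L one) x ->
  exists y : ser, svalid L y /\ is_lead y v /\ 0 < y v /\ slog L lL log y = x /\
    forall Q, sgrp Q -> Q v -> (forall z, x z <> 0 -> Q z) -> forall z, y z <> 0 -> Q z.
Proof.
move=> vx vv lv.
pose e := restr (fun z => z <! one) x.
have ie : inft e by split; [exact: svalid_restr|move=> z h; have [] := restr_neq0 _ _ _ h].
have [d [id_ [de dQ]]] := slogsum_surj e ie.
have [b [b0 be]] := logP.2.2 (x one).
pose y z := b * (sone L (gi v ** z) + d (gi v ** z)).
have d1 : d one = 0 by apply: NNPP => /id_.2; apply: girr.
have yv : y v = b by rewrite /y gmulC mulgi /sone mono_same d1 addr0 mulr1.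
have bn0 : b <> 0 by apply/eqP; rewrite gt_eqF.
have vy : svalid L y.
  apply: (svalid_shift (fun z => sone L z + d z)); last exact: valid_gi.
  by apply: svalid_add; [exact: svalid_sone|exact: id_.1].
have ly : is_lead y v.
  split; first by rewrite yv.
  move=> z /mul_neq0 [_ /add_neq0 [h|/id_.2 h]].
    by left; apply: (mulg_inj (gi v)); rewrite (sone_neq0 _ h) gmulC mulgi.
  by right; have := ltgM2l _ _ v h; rewrite mulKgi mulgx1.
exists y; do 3![split=> //]; first by rewrite yv.
split; last first.
  move=> Q gQ Qv xQ z /mul_neq0 [_ h]; have [Q1 [QM QV]] := gQ.
  rewrite -(mulKgi v z); apply: QM => //.
  case: (add_neq0 _ _ h) => [h'|]; first by rewrite (sone_neq0 _ h').
  by apply: (dQ Q) => // u h'; apply: xQ; have [] := restr_neq0 _ _ _ h'.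
have ed : seps y v = d.
  apply: functional_extensionality => z.
  rewrite /seps yv /y mulgiK mulrA mulVf ?mul1r; last exact/eqP.
  by rewrite addrAC subrr add0r.
rewrite (slogE y v) // ed de yv be lv; apply: functional_extensionality => z.
case: (classic (z = one)) => [->|n1].
  by rewrite /e !restrF ?add0r ?addr0; do ?exact: girr; rewrite /sone mono_same mulr1.
rewrite /sone mono_diff // mulr0 addr0 /e.
case: (x z =P 0) => [xz|xz]; first by rewrite !restr0 // xz addr0.
have vz : V z by apply: vx.2.
case: (gtotal one z gv1 vz) => [z1|[e1|z1]]; last 1 first.
- by rewrite restrF ?restrT ?add0r //; apply: leg_nlt => //; [exact: gv1|right].
- by rewrite restrT // restrF ?addr0 //; apply: leg_nlt => //; [exact: gv1|right].
by case: n1.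
Qed.
End Log.

Lemma ser_pos_lead (a : ser) : ser_pos (ltl L) a <-> exists v, is_lead a v /\ 0 < a v.
Proof.
split=> [[m [am h]]|[m [[_ h] am]]]; exists m; split=> //; split=> //.
by apply/eqP; rewrite gt_eqF.
Qed.
End Hahn.

Lemma ser_pos_add {k : realFieldType} {L : lvl k} (G : good L) (a b : car L -> k) :
  svalid L a -> svalid L b -> ser_pos (ltl L) a -> ser_pos (ltl L) b ->
  ser_pos (ltl L) (fun x => a x + b x).
Proof.
move=> va vb /ser_pos_lead [v [[av lv] v0]] /ser_pos_lead [w [[bw lw] w0]].
have vv := va.2 _ av; have vw := vb.2 _ bw.
have key u : validl L u -> leg v u -> leg w u -> 0 < a u + b u ->
    ser_pos (ltl L) (fun x => a x + b x).
  move=> vu vlu wlu u0; exists u; split=> // z h.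
  have vz : validl L z by have [/va.2|/vb.2] := add_neq0 _ _ h.
  case: (add_neq0 _ _ h) => [/lv|/lw] hz; exact: (leg_trans G) hz _.
have lt0 (c : car L -> k) x y : (forall z, c z <> 0 -> leg z x) -> validl L x -> validl L y ->
    ltl L x y -> c y = 0.
  by move=> hc vx vy xy; apply: NNPP => /hc /(leg_nlt G x y vx vy).
case: (good_total _ G v w vv vw) => [vw'|[e|vw']].
- apply: (key w) => //; [by right|by left|].
  by rewrite (lt0 a v w) // add0r.
- by apply: (key w) => //; [by left|by left|]; rewrite -e addr_gt0 // e.
apply: (key v) => //; [by left|by right|].
by rewrite (lt0 b w v) // addr0.
Qed.

Lemma ser_pos_total {k : realFieldType} {L : lvl k} (G : good L) (a : car L -> k) :
  svalid L a -> ser_pos (ltl L) a \/ a = (fun _ => 0) \/ ser_pos (ltl L) (fun x => - a x).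
Proof.
move=> va; case: (classic (exists x, a x <> 0)) => [ex|nx]; last first.
  right; left; apply: functional_extensionality => x; apply: NNPP => ax; apply: nx; by exists x.
have [v [av lv]] := lead_exists G a va ex.
have /orP[h|h] : (0 < a v) || (a v < 0) by rewrite orbC; apply: lt_total; apply/eqP.
  by left; exists v.
right; right; exists v; rewrite oppr_gt0; split=> // z h'; apply: lv => e.
by apply: h'; rewrite e oppr0.
Qed.

Lemma good_next {k : realFieldType} (L : lvl k) : good L -> good (next L).
Proof.
move=> G.
have vsub (a b : car L -> k) : svalid L a -> svalid L b -> svalid L (fun x => b x - a x).
  by move=> va vb; apply: (svalid_add G) => //; apply: (svalid_opp G).
split=> /=.
- by move=> x y z; apply: functional_extensionality => u; rewrite addrA.
- by move=> x y; apply: functional_extensionality => u; rewrite addrC.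
- by move=> x; apply: functional_extensionality => u; rewrite add0r.
- by move=> x; exists (fun u => - x u); apply: functional_extensionality => u; rewrite subrr.
- by move=> x [m [+ _]]; rewrite subrr ltxx.
- move=> x y z [vx _] [vy _] [vz _] xy yz.
  have := ser_pos_add G _ _ (vsub _ _ vx vy) (vsub _ _ vy vz) xy yz.
  rewrite /ser_lt; congr ser_pos; apply: functional_extensionality => u.
  by rewrite addrC addrA subrK.
- move=> x y [vx _] [vy _].
  case: (ser_pos_total G _ (vsub _ _ vx vy)) => [h|[h|h]]; [by left|right; left|right; right].
    apply: functional_extensionality => u; apply/esym/eqP; rewrite -subr_eq0; apply/eqP.
    by have := f_equal (fun g => g u) h.
  move: h; rewrite /ser_lt; congr ser_pos; apply: functional_extensionality => u.
  by rewrite opprB.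
- move=> x y z; rewrite /ser_lt; congr ser_pos; apply: functional_extensionality => u.
  by rewrite opprD addrACA subrr addr0.
- by split; [exact: svalid0|].
- move=> x y [vx x1] [vy y1]; split; first exact: (svalid_add G).
  by move=> u h; have [/x1|/y1] := add_neq0 _ _ h.
move=> x y e [vx x1].
have -> : y = (fun u => - x u).
  apply: functional_extensionality => u; have := f_equal (fun g => g u) e => /= /eqP.
  by rewrite addrC addr_eq0 => /eqP.
split; first exact: (svalid_opp G).
by move=> u h; apply: x1 => e'; apply: h; rewrite e' oppr0.
Qed.

(** * Functoriality *)

Section Push.
Context {k : realFieldType} {A B : Type} (f : A -> B).
Hypothesis fI : injective f.

Lemma push_at (a : A -> k) x : push f a (f x) = a x.
Proof.
rewrite /push (fsum1 _ _ x) //; first by move=> y [/fI].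
by move=> n; apply: NNPP => h; apply: n.
Qed.

Lemma push_neq0 (a : A -> k) y : push f a y <> 0 -> exists x, y = f x /\ a x <> 0.
Proof. by move=> /fsum_neq0 [x [<- h]]; exists x. Qed.

(** The usual way to prove an identity about [push]: compare values on the image and show that
    nothing lies off it. *)
Lemma push_eq (a : A -> k) (b : B -> k) : (forall x, b (f x) = a x) ->
  (forall y, b y <> 0 -> exists x, y = f x) -> b = push f a.
Proof.
move=> ba b0; apply: functional_extensionality => y.
case: (classic (exists x, y = f x)) => [[x ->]|n]; first by rewrite push_at.
have -> : b y = 0 by apply: NNPP => /b0.
by apply: NNPP => h; have [x [e _]] := push_neq0 a y (nesym h); apply: n; exists x.
Qed.

Lemma push_inj : injective (@push k _ _ f).
Proof.
move=> a b e; apply: functional_extensionality => x.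
by rewrite -(push_at a) e push_at.
Qed.

Lemma push_add (a b : A -> k) :
  push f (fun x => a x + b x) = (fun y => push f a y + push f b y).
Proof.
apply/esym/push_eq => [x|y h]; first by rewrite !push_at.
by have [/push_neq0|/push_neq0] := add_neq0 _ _ h; move=> [x [-> _]]; exists x.
Qed.

Lemma push_opp (a : A -> k) : push f (fun x => - a x) = (fun y => - push f a y).
Proof.
apply/esym/push_eq => [x|y h]; first by rewrite !push_at.
have /push_neq0 [x [-> _]] : push f a y <> 0 by move=> e; apply: h; rewrite e oppr0.
by exists x.
Qed.

Lemma push_sub (a b : A -> k) :
  push f (fun x => a x - b x) = (fun y => push f a y - push f b y).
Proof. by rewrite push_add push_opp. Qed.

Lemma push_scale c (a : A -> k) : push f (fun x => c * a x) = (fun y => c * push f a y).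
Proof.
apply/esym/push_eq => [x|y /mul_neq0 [_ /push_neq0 [x [-> _]]]]; last by exists x.
by rewrite !push_at.
Qed.

Lemma push0 : push f (fun _ => 0 : k) = (fun _ => 0).
Proof. by apply/esym/push_eq. Qed.

Lemma push_mono x : push f (mono x : A -> k) = mono (f x).
Proof.
apply/esym/push_eq => [y|y h]; last by exists x; apply: mono_neq0 h.
case: (classic (y = x)) => [->|n]; first by rewrite !mono_same.
by rewrite !mono_diff // => /fI.
Qed.

Lemma push_restr (P : A -> Prop) (Q : B -> Prop) (a : A -> k) :
  (forall x, a x <> 0 -> P x <-> Q (f x)) -> push f (restr P a) = restr Q (push f a).
Proof.
move=> PQ; apply/esym/push_eq => [x|y h].
  case: (a x =P 0) => [e|/PQ [PQx QPx]]; first by rewrite !restr0 ?push_at.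
  case: (classic (P x)) => h; first by rewrite !restrT ?push_at //; apply: PQx.
  by rewrite !restrF // => /QPx.
by have [_ /push_neq0 [x [-> _]]] := restr_neq0 _ _ _ h; exists x.
Qed.
End Push.
Arguments push_neq0 {k A B f a y}.

Lemma push_push {k : realFieldType} {A B C : Type} (f : A -> B) (g : B -> C) (a : A -> k) :
  injective f -> injective g -> push g (push f a) = push (g \o f) a.
Proof.
move=> fI gI; apply: push_eq => [|x|y]; first exact: inj_comp.
  by rewrite /= push_at // push_at.
by move=> /push_neq0 [x [-> /push_neq0 [z [-> _]]]]; exists z.
Qed.

(** Common interface of the embeddings [iota] between levels and of the iterates [psis]. The
    equivalence in [lemb_valid] is what allows valid series to be pulled back as well as pushed. *)
Record lemb {k : realFieldType} (L L' : lvl k) (f : car L -> car L') : Prop := Lemb {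
  lemb_inj : injective f;
  lemb_mul : forall x y, f (mull L x y) = mull L' (f x) (f y);
  lemb_lt : forall x y, ltl L x y -> ltl L' (f x) (f y);
  lemb_valid : forall x, validl L x <-> validl L' (f x) }.
Arguments lemb {k} L L' f.
Arguments lemb_inj {k L L' f}. Arguments lemb_mul {k L L' f}.
Arguments lemb_lt {k L L' f}. Arguments lemb_valid {k L L' f}.

Section Embedding.
Context {k : realFieldType} {L L' : lvl k} (f : car L -> car L').
Hypotheses (G : good L) (G' : good L') (F : lemb L L' f).
Let fI : injective f := lemb_inj F.

Lemma lemb_one : f (onel L) = onel L'.
Proof.
apply: (mulg_inj G' (f (onel L))).
by rewrite -(lemb_mul F) good_mul1 // (mulgx1 G').
Qed.

Lemma lemb_lt_iff x y : validl L x -> validl L y -> ltl L x y <-> ltl L' (f x) (f y).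
Proof.
move=> vx vy; split; first exact: (lemb_lt F).
case: (good_total _ G x y vx vy) => [//|[->|/(lemb_lt F) h1 h2]]; first by move=> /(good_irr _ G').
have vfx := (lemb_valid F x).1 vx; have vfy := (lemb_valid F y).1 vy.
by case: (good_irr _ G' (f x)); apply: (good_trans _ G') h2 h1.
Qed.

Lemma svalid_push a : svalid L a <-> svalid L' (push f a).
Proof.
split=> [[wa va]|[wa va]].
  split=> [S hS [y Sy]|y /push_neq0 [x [-> /va]]]; last by move/(lemb_valid F).
  have /push_neq0 [x0 [e0 a0]] := hS _ Sy.
  have [||m [Sm mx]] := wa (fun x => S (f x)).
  - by move=> x /hS; rewrite push_at.
  - by exists x0; rewrite -e0.
  have am : a m <> 0 by have := hS _ Sm; rewrite push_at.
  exists (f m); split=> // z Sz; have /push_neq0 [x [ex ax]] := hS _ Sz.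
  rewrite ex => /lemb_lt_iff h; apply: (mx x); first by rewrite -ex.
  by apply: h; apply: va.
split=> [S hS [x Sx]|y ay]; last by apply/(lemb_valid F)/va; rewrite push_at.
have [||_ [[m [-> Sm]] mx]] := wa (fun y => exists x, y = f x /\ S x).
- by move=> y [z [-> /hS]]; rewrite push_at.
- by exists (f x), x.
exists m; split=> // y Sy /(lemb_lt F) h.
by apply: (mx (f y)) => //; exists y.
Qed.

Lemma push_gt1 (a : car L -> k) : svalid L a ->
  (forall y, a y <> 0 -> ltl L (onel L) y) <->
  (forall y, push f a y <> 0 -> ltl L' (onel L') y).
Proof.
move=> va; split=> h y.
  by move=> /push_neq0 [x [-> /h /(lemb_lt F)]]; rewrite lemb_one.
move=> ay; apply/lemb_lt_iff; [exact: good_v1|exact: va.2|rewrite lemb_one].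
by apply: h; rewrite push_at.
Qed.

Lemma ser_pos_push (a : car L -> k) : ser_pos (ltl L) a -> ser_pos (ltl L') (push f a).
Proof.
move=> [m [am h]]; exists (f m); rewrite push_at //; split=> // z /push_neq0 [x [-> /h [->|]]].
  by left.
by move=> /(lemb_lt F); right.
Qed.

(** The induction step that carries [l] and [psi] up the tower. *)
Lemma lemb_push : lemb (next L) (next L') (push f).
Proof.
split=> /=; first exact: push_inj.
- by move=> a b; apply: push_add.
- move=> a b; rewrite /ser_lt => /ser_pos_push; by rewrite push_sub.
move=> a; split=> [[va a1]|[va a1]].
  by split; [exact/svalid_push|apply/push_gt1].
have va' : svalid L a by apply/svalid_push.
by split=> //; apply/push_gt1.
Qed.

Lemma smul_push (a b : car L -> k) :
  smul L' (push f a) (push f b) = push f (smul L a b).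
Proof.
apply: push_eq => // [z|y].
  apply: (fsum_inj (fun p : car L * car L => (f p.1, f p.2))).
  - by move=> [x y] [x' y'] /= [/fI -> /fI ->].
  - move=> [x y] /=; split; last first.
      by move=> [[x' y'] /= [[<- [ax ay]] [-> ->]]]; rewrite !push_at // lemb_mul.
    move=> [e [/push_neq0 [x' [ex ax]] /push_neq0 [y' [ey ay]]]].
    exists (x', y') => /=; rewrite -ex -ey; split=> //; split=> //.
    by apply: fI; rewrite (lemb_mul F) -ex -ey.
  by move=> [x y] _ /=; rewrite !push_at.
move=> /smul_neq0 [u [w [/push_neq0 [x [-> _]] [/push_neq0 [x' [-> _]] ->]]]].
by exists (mull L x x'); rewrite (lemb_mul F).
Qed.

Lemma sone_push : sone L' = push f (sone L).
Proof. by rewrite /sone push_mono // lemb_one. Qed.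

Lemma sexp_push (e : car L -> k) i : sexp L' (push f e) i = push f (sexp L e i).
Proof.
elim: i => [|i IH]; first exact: sone_push.
by rewrite -smul_push -IH.
Qed.

Lemma slogsum_push (e : car L -> k) : slogsum L' (push f e) = push f (slogsum L e).
Proof.
apply: push_eq => // [z|y].
  by apply: fsum_ext => [i|i _]; rewrite sexp_push push_at.
by move=> /slogsum_neq0 [i]; rewrite sexp_push => /push_neq0 [x [-> _]]; exists x.
Qed.

Lemma is_lead_push (a : car L -> k) v : is_lead a v -> is_lead (push f a) (f v).
Proof.
move=> [av lv]; split; first by rewrite push_at.
move=> z /push_neq0 [x [-> /lv [->|/(lemb_lt F)]]]; by [left|right].
Qed.

Lemma seps_push (a : car L -> k) v : seps (push f a) (f v) = push f (seps a v).
Proof.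
apply: push_eq => // [z|y].
  by rewrite /seps -(lemb_mul F) !push_at // sone_push push_at.
rewrite /seps => h; have := add_neq0 _ _ h; rewrite sone_push.
case=> [/mul_neq0 [_ /push_neq0 [x [e _]]]|h'].
  exists (mull L (gi G v) x); rewrite (lemb_mul F) -e good_mulA // -(lemb_mul F).
  by rewrite (good_mulC _ G (gi G v)) mulgi lemb_one good_mul1.
have /push_neq0 [x [-> _]] : push f (sone L) y <> 0 by move=> e; apply: h'; rewrite e oppr0.
by exists x.
Qed.

Lemma slog_push (lL : car L -> car L -> k) (lL' : car L' -> car L' -> k) log (a : car L -> k) v :
  svalid L a -> is_lead a v -> lL' (f v) = push f (lL v) ->
  slog L' lL' log (push f a) = push f (slog L lL log a).
Proof.
move=> va lv el.
have va' : svalid L' (push f a) by apply/svalid_push.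
rewrite (slogE G lL log a v va lv) (slogE G' lL' log _ (f v) va' (is_lead_push a v lv)).
rewrite push_at // !push_add // seps_push slogsum_push el sone_push.
by rewrite push_scale.
Qed.

Lemma sinv_push (a : car L -> k) : svalid L a -> (exists x, a x <> 0) ->
  sinv L' (push f a) = push f (sinv L a).
Proof.
move=> va /(inverse_exists G a va) [b [vb [ab _]]].
rewrite (sinv_eq G a b) //; apply: (sinv_eq G'); [exact/svalid_push|exact/svalid_push|].
by rewrite smul_push ab sone_push.
Qed.
End Embedding.

(** * The tower of exponential extensions *)

Section Tower.
Variables (k : realFieldType) (log : k -> k) (O : ogroup) (l : O -> O -> k) (psi : O -> O).
Hypotheses (HO : ordered_abelian_group O) (Hlog : surjective_log log)
  (Hl : prelog_section O l) (Hpsi : lmorphism O l psi).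
Local Notation lv := (@level k O).
Local Notation C n := (car (lv n)).
Local Notation io := (iota O l).
Local Notation EL := (EL k O).
Local Notation lev x := (projT1 (x : EL)).
Local Notation mk n a := (existT (fun j => C j -> k) n a : EL).

Lemma good_level n : good (lv n).
Proof.
elim: n => [|n IH]; last exact: good_next.
case: HO => [hA [hC [h1 [hV [hi [ht [hT hM]]]]]]].
by split=> //= x y z _ _ _; apply: ht.
Qed.

Lemma glt_inj {T : Type} (f : O -> T) (lt : T -> T -> Prop) :
  (forall x, ~ lt x x) -> (forall x y, glt O x y -> lt (f x) (f y)) -> injective f.
Proof.
move=> irr flt x y e; case: HO => [_ [_ [_ [_ [_ [_ [hT _]]]]]]].
by case: (hT x y) => [/flt|[//|/flt]]; rewrite e => /irr.
Qed.

Lemma lemb_iota n : lemb (lv n) (lv n.+1) (io n).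
Proof.
elim: n => [|n IH]; last exact: (lemb_push _ (good_level n) (good_level n.+1) IH).
case: Hl => [h1 [h2 h3]]; split=> //=.
exact: (glt_inj l (ser_lt (glt O)) (good_irr _ (good_level 1%N)) h3).
Qed.

Lemma lemb_psis n : lemb (lv n) (lv n) (psis O psi n).
Proof.
elim: n => [|n IH]; last exact: (lemb_push _ (good_level n) (good_level n) IH).
case: Hpsi => [h1 [h2 h3]]; split=> //=.
exact: (glt_inj psi (glt O) (good_irr _ (good_level 0%N)) h2).
Qed.

Lemma iota_inj n : injective (io n).
Proof. exact: lemb_inj (lemb_iota n). Qed.

Lemma psis_inj n : injective (@psis k O psi n).
Proof. exact: lemb_inj (lemb_psis n). Qed.

(** The iterates of [psi] extend one another. The base case is the morphism condition
    [psi o l = l o psi], and functoriality of [push] does the rest. *)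
Lemma psis_iota n x : psis O psi n.+1 (io n x) = io n (psis O psi n x).
Proof.
elim: n x => [|n IH] x; first by case: Hpsi => [_ [_ h]]; apply: h.
change (push (psis O psi n.+1) (push (io n) x) = push (io n) (push (psis O psi n) x)).
rewrite !push_push; do ?[exact: iota_inj | exact: psis_inj].
congr push; apply: functional_extensionality => y; exact: IH.
Qed.

Lemma iota_ser n v : validl (lv n) v ->
  svalid (lv n) (io n v) /\ forall y, io n v y <> 0 -> ltl (lv n) (onel (lv n)) y.
Proof. by move/(lemb_valid (lemb_iota n)). Qed.

(** * Transport of EL-series to a common level *)

Lemma uptoE N n (a : C n -> k) : upto O l N n a =
  match PeanoNat.Nat.eq_dec n N with
  | left h => Some (eq_rect n (fun j => C j -> k) a N h)
  | right _ => match N return option (C N -> k) with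
               | 0%N => None
               | N'.+1 => option_map (io N'.+1) (upto O l N' n a)
               end
  end.
Proof. by case: N. Qed.

Lemma upto_id n (a : C n -> k) : upto O l n n a = Some a.
Proof.
rewrite uptoE; case: (PeanoNat.Nat.eq_dec n n) => // e.
(* Equality proofs between natural numbers are unique, so the cast along [e] is the identity. *)
by rewrite (eq_irrelevance e (erefl _)).
Qed.

Lemma upto_S N n (a : C n -> k) : (n <= N)%N ->
  upto O l N.+1 n a = option_map (io N.+1) (upto O l N n a).
Proof.
move=> nN; rewrite uptoE; case: (PeanoNat.Nat.eq_dec n N.+1) => // e.
by exfalso; move: nN; rewrite e ltnn.
Qed.

Lemma upto_lt N n (a : C n -> k) : (N < n)%N -> upto O l N n a = None.
Proof.
elim: N => [|N IH] Nn; rewrite uptoE; case: (PeanoNat.Nat.eq_dec n _) => e.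
- by exfalso; move: Nn; rewrite e ltnn.
- by [].
- by exfalso; move: Nn; rewrite e ltnn.
by rewrite IH // ltnW.
Qed.

Lemma upto_toN N (x : EL) : (lev x <= N)%N ->
  upto O l N (lev x) (projT2 x) = Some (toN l N x).
Proof.
case: x => n a; change ((n <= N)%N -> upto O l N n a = Some (toN l N (mk n a))) => nN.
rewrite /toN; suff [b eb] : exists b, upto O l N n a = Some b by rewrite /= eb.
elim: N nN => [|N IH]; rewrite leq_eqVlt => /orP[/eqP e|].
- by subst n; exists a; apply: upto_id.
- by [].
- by subst n; exists a; apply: upto_id.
by rewrite ltnS => nN; have [b hb] := IH nN; exists (io N.+1 b); rewrite upto_S // hb.
Qed.

Lemma toN_id (x : EL) : toN l (lev x) x = projT2 x.
Proof. by rewrite /toN upto_id. Qed.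

Lemma toN_S N (x : EL) : (lev x <= N)%N -> toN l N.+1 x = push (io N) (toN l N x).
Proof. by move=> xN; rewrite {1}/toN upto_S // upto_toN. Qed.

Lemma toN_ind (P : forall N, (C N -> k) -> Prop) (x : EL) : P (lev x) (projT2 x) ->
  (forall N a, P N a -> P N.+1 (push (io N) a)) ->
  forall N, (lev x <= N)%N -> P N (toN l N x).
Proof.
move=> P0 PS; elim=> [|N IH]; rewrite leq_eqVlt => /orP[/eqP e|].
- by rewrite -e toN_id.
- by [].
- by rewrite -e toN_id.
by rewrite ltnS => xN; rewrite toN_S //; apply/PS/IH.
Qed.

Lemma toN_eq_up (x y : EL) N d : (lev x <= N)%N -> (lev y <= N)%N ->
  toN l (N + d) x = toN l (N + d) y <-> toN l N x = toN l N y.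
Proof.
move=> xN yN; elim: d => [|d IH]; first by rewrite addn0.
rewrite addnS !toN_S ?(leq_trans _ (leq_addr d N)) // -IH.
by split=> [/(push_inj _ (iota_inj _))|->].
Qed.

(** The embeddings are injective, so equality in the union can be tested at any level that holds
    both elements. *)
Lemma eqEL_toN (x y : EL) N : (lev x <= N)%N -> (lev y <= N)%N ->
  eqEL l x y <-> toN l N x = toN l N y.
Proof.
move=> xN yN; split; last first.
  by move=> e; exists N; rewrite !upto_toN // e.
case=> M [nM eM].
have xM : (lev x <= M)%N by rewrite leqNgt; apply/negP => /upto_lt h; apply: nM.
have yM : (lev y <= M)%N.
  by rewrite leqNgt; apply/negP => /upto_lt h; apply: nM; rewrite eM h.
move: eM; rewrite !upto_toN // => -[eM].
case: (leqP N M) => [NM|/ltnW MN].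
  by apply/(toN_eq_up x y N (M - N)) => //; rewrite subnKC.
by rewrite -(subnKC MN); apply/toN_eq_up.
Qed.

Lemma eqEL_sym x y : eqEL l x y -> eqEL l y x.
Proof.
have xN := leq_maxl (lev x) (lev y); have yN := leq_maxr (lev x) (lev y).
by move=> /(eqEL_toN _ _ _ xN yN) e; apply/(eqEL_toN _ _ _ yN xN).
Qed.

Lemma eqEL_trans y x z : eqEL l x y -> eqEL l y z -> eqEL l x z.
Proof.
pose N := maxn (lev x) (maxn (lev y) (lev z)).
have xN : (lev x <= N)%N by rewrite leq_maxl.
have yN : (lev y <= N)%N by rewrite !leq_max leqnn orbT.
have zN : (lev z <= N)%N by rewrite !leq_max leqnn !orbT.
by rewrite (eqEL_toN x y N) // (eqEL_toN y z N) // (eqEL_toN x z N) // => -> ->.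
Qed.

Lemma toN_valid (x : EL) N : (lev x <= N)%N -> validEL x <-> svalid (lv N) (toN l N x).
Proof.
elim: N => [|N IH]; rewrite leq_eqVlt => /orP[/eqP e|].
- by rewrite -e toN_id.
- by [].
- by rewrite -e toN_id.
rewrite ltnS => xN; rewrite toN_S // IH //.
by apply: svalid_push; [exact: good_level|exact: good_level|exact: lemb_iota].
Qed.

(** [D] is the domain on which the operation commutes with the embeddings: nonzero series for
    inverses, series with a leading exponent for logarithms. It has to survive the passage to the
    next level. *)
Lemma toN_op (op : forall n, (C n -> k) -> C n -> k) (D : forall n, (C n -> k) -> Prop) :
  (forall n a, D n a -> D n.+1 (push (io n) a) /\ op n.+1 (push (io n) a) = push (io n) (op n a)) ->
  forall (x : EL) N, D (lev x) (projT2 x) -> (lev x <= N)%N ->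
  toN l N (mk (lev x) (op (lev x) (projT2 x))) = op N (toN l N x).
Proof.
move=> h x N Dx xN.
suff [] : D N (toN l N x) /\ toN l N (mk (lev x) (op (lev x) (projT2 x))) = op N (toN l N x) by [].
elim: N xN => [|N IH]; rewrite leq_eqVlt => /orP[/eqP e|].
- by rewrite -e toN_id (toN_id (mk _ _)).
- by [].
- by rewrite -e toN_id (toN_id (mk _ _)).
rewrite ltnS => xN; rewrite toN_S // toN_S //.
by have [DN ->] := IH xN; have [? ->] := h _ _ DN.
Qed.

Lemma toN_bin (op : forall n, (C n -> k) -> (C n -> k) -> C n -> k) :
  (forall n a b, op n.+1 (push (io n) a) (push (io n) b) = push (io n) (op n a b)) ->
  forall (x y : EL) N, (lev x <= N)%N -> (lev y <= N)%N ->
  toN l N (binEL l op x y) = op N (toN l N x) (toN l N y).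
Proof.
move=> h x y N xN yN; have : (maxn (lev x) (lev y) <= N)%N by rewrite geq_max xN.
elim: N {xN yN} => [|N IH]; rewrite leq_eqVlt => /orP[/eqP e|].
- by rewrite -e (toN_id (binEL l op x y)).
- by [].
- by rewrite -e (toN_id (binEL l op x y)).
rewrite ltnS => xyN; rewrite toN_S // IH //; move: xyN; rewrite geq_max => /andP[xN yN].
by rewrite !toN_S // h.
Qed.

Lemma toN_add (x y : EL) N : (lev x <= N)%N -> (lev y <= N)%N ->
  toN l N (addEL l x y) = fun z => toN l N x z + toN l N y z.
Proof.
move=> xN yN; rewrite (toN_bin (fun N a b z => a z + b z)) // => n a b.
by rewrite push_add //; apply: iota_inj.
Qed.

Lemma toN_mul (x y : EL) N : (lev x <= N)%N -> (lev y <= N)%N ->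
  toN l N (mulEL l x y) = smul (lv N) (toN l N x) (toN l N y).
Proof.
move=> xN yN; rewrite (toN_bin (fun N a b => smul (lv N) a b)) // => n a b.
exact: (smul_push (io n) (lemb_iota n)).
Qed.

Lemma toN_opp (x : EL) N : (lev x <= N)%N -> toN l N (oppEL x) = fun z => - toN l N x z.
Proof.
move=> xN; apply: (toN_op (fun n a z => - a z) (fun _ _ => True)) => // n a _.
by split=> //; rewrite push_opp //; apply: iota_inj.
Qed.

Lemma toN_inv (x : EL) N : validEL x -> (exists z, projT2 x z <> 0) -> (lev x <= N)%N ->
  toN l N (invEL x) = sinv (lv N) (toN l N x).
Proof.
move=> vx ex xN.
apply: (toN_op (fun n a => sinv (lv n) a) (fun n a => svalid (lv n) a /\ exists z, a z <> 0)) => //.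
move=> n a [va [z az]].
have gn := good_level n; have gn' := good_level n.+1; have F := lemb_iota n.
split; last by apply: (sinv_push (io n) gn gn' F) => //; exists z.
split; first exact/(svalid_push (io n) gn gn' F).
by exists (io n z); rewrite push_at //; apply: iota_inj.
Qed.

Lemma toN_Log (x : EL) N : validEL x -> (exists v, is_lead (projT2 x) v) -> (lev x <= N)%N ->
  toN l N (LogEL l log x) = slog (lv N) (io N) log (toN l N x).
Proof.
move=> vx ex xN.
apply: (toN_op (fun n a => slog (lv n) (io n) log a)
  (fun n a => svalid (lv n) a /\ exists v, is_lead a v)) => // n a [va [v lva]].
have gn := good_level n; have gn' := good_level n.+1; have F := lemb_iota n.
split; last exact: (slog_push (io n) gn gn' F _ _ _ _ v).
split; first exact/(svalid_push (io n) gn gn' F).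
by exists (io n v); apply: (is_lead_push (io n) F).
Qed.

Lemma toN_psi (x : EL) N : (lev x <= N)%N ->
  toN l N (psiEL psi x) = push (psis O psi N) (toN l N x).
Proof.
move=> xN; apply: (toN_op (fun n a => push (psis O psi n) a) (fun _ _ => True)) => // n a _.
by split=> //; apply: (psis_iota n.+1 a).
Qed.

Lemma toN_zero N : toN l N (zeroEL : EL) = fun _ => 0.
Proof.
elim: N => [|N IH]; first exact: (toN_id zeroEL).
by rewrite toN_S // IH push0 //; apply: iota_inj.
Qed.

Lemma toN_one N : toN l N (oneEL : EL) = sone (lv N).
Proof.
elim: N => [|N IH]; first exact: (toN_id oneEL).
rewrite toN_S // IH; apply/esym/sone_push; [exact: good_level|exact: good_level|].
exact: lemb_iota.
Qed.

Lemma posEL_lead (x : EL) : posEL l x <-> exists v, is_lead (projT2 x) v /\ 0 < projT2 x v.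
Proof.
rewrite -ser_pos_lead /posEL /ltEL; move e: (maxn _ _) => N.
have {}e : N = lev x by rewrite -e max0n.
rewrite e toN_id toN_zero.
have -> : (fun z => projT2 x z - 0) = projT2 x; last by [].
by apply: functional_extensionality => z; rewrite subr0.
Qed.

Lemma lead_toN (x : EL) v : is_lead (projT2 x) v -> 0 < projT2 x v ->
  forall N, (lev x <= N)%N -> exists w, is_lead (toN l N x) w /\ 0 < toN l N x w.
Proof.
move=> lx v0; apply: (toN_ind (fun N a => exists w, is_lead a w /\ 0 < a w)); first by exists v.
move=> N a [w [lw w0]]; exists (io N w); split; first exact: (is_lead_push _ (lemb_iota N)).
by rewrite push_at //; apply: iota_inj.
Qed.

Lemma Log_inj (x y : EL) : validEL x -> validEL y -> posEL l x -> posEL l y ->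
  eqEL l (LogEL l log x) (LogEL l log y) -> eqEL l x y.
Proof.
move=> vx vy /posEL_lead [v [lx x0]] /posEL_lead [w [ly y0]].
have xN := leq_maxl (lev x) (lev y); have yN := leq_maxr (lev x) (lev y).
move: (maxn _ _) xN yN => N xN yN.
move=> /(eqEL_toN (LogEL l log x) (LogEL l log y) N xN yN) e.
apply/(eqEL_toN x y N xN yN).
have [v' [lx' x0']] := lead_toN x v lx x0 N xN.
have [w' [ly' y0']] := lead_toN y w ly y0 N yN.
move: e; rewrite (toN_Log x N vx (ex_intro _ v lx) xN) (toN_Log y N vy (ex_intro _ w ly) yN).
have l1 u z : validl (lv N) u -> io N u z <> 0 -> ltl (lv N) (onel (lv N)) z.
  by move=> vu; apply: (iota_ser N u vu).2.
have lI a b (_ : validl (lv N) a) (_ : validl (lv N) b) : io N a = io N b -> a = b.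
  exact: iota_inj.
exact: (slog_inj (good_level N) (io N) log l1 Hlog _ _ v' w' lI
  ((toN_valid x N xN).1 vx) ((toN_valid y N yN).1 vy) lx' ly' x0' y0').
Qed.

(** [ExpEL] picks some positive preimage under the logarithm; by injectivity any known one is equal
    to it. *)
Lemma ExpEL_eq (x y : EL) : validEL y -> posEL l y -> eqEL l (LogEL l log y) x ->
  eqEL l (ExpEL l log x) y.
Proof.
move=> vy py ey; rewrite /ExpEL; case: excluded_middle_informative => [h|[]]; last by exists y.
case: (constructive_indefinite_description _ h) => z /= [vz [pz ez]].
by apply: Log_inj => //; apply: (eqEL_trans x) ez (eqEL_sym _ _ ey).
Qed.

(** The formal symbol [e(f)] is indeed [Exp f]: the logarithm of the monomial [f] is [iota] of [f],
    which is the series [f] seen one level up. *)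
Lemma Exp_mono n (f : C n -> k) : validl (lv n.+1) f ->
  eqEL l (ExpEL l log (mk n f)) (monoEL n.+1 f).
Proof.
move=> vf; have gn := good_level n.+1; apply: ExpEL_eq.
- exact: (svalid_mono gn).
- by apply/posEL_lead; exists f; split; [exact: is_lead_mono|rewrite /= mono_same].
apply/(eqEL_toN _ _ n.+1) => //.
rewrite (toN_id (LogEL l log (monoEL n.+1 f))) toN_S // (toN_id (mk n f)).
exact: (slog_mono gn (io n.+1) log Hlog f vf).
Qed.

Lemma mulEL_eqr (x y y' : EL) : eqEL l y y' -> eqEL l (mulEL l x y) (mulEL l x y').
Proof.
pose N := maxn (lev x) (maxn (lev y) (lev y')).
have xN : (lev x <= N)%N by rewrite leq_maxl.
have yN : (lev y <= N)%N by rewrite !leq_max leqnn orbT.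
have zN : (lev y' <= N)%N by rewrite !leq_max leqnn !orbT.
move=> /(eqEL_toN y y' N yN zN) e; apply/(eqEL_toN _ _ N); rewrite ?geq_max ?xN //.
by rewrite !toN_mul // e.
Qed.

Lemma smul_mono n (a b : C n) : smul (lv n) (mono a) (mono b) = mono (mull (lv n) a b).
Proof.
have gn := good_level n.
have -> : (mono b : C n -> k) = (fun y => 1 * mono b y).
  by apply: functional_extensionality => y; rewrite mul1r.
apply: functional_extensionality => z; rewrite (smul_cmono gn) mul1r.
case: (classic (z = mull (lv n) a b)) => [->|nz].
  by rewrite (good_mulC _ gn a) (mulgiK gn) !mono_same.
rewrite !mono_diff // => e; apply: nz.
by rewrite -e good_mulC // (mulKgi gn).
Qed.

(** The group law of [G^{#(n+1)}] in additive form. The factor [x] may live at a lower level, as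
    elements of [H] do. *)
Lemma mono_mul_Exp n (x : EL) (g f : C n -> k) : (lev x <= n.+1)%N ->
  toN l n.+1 x = mono g -> validl (lv n.+1) f ->
  eqEL l (mulEL l x (ExpEL l log (mk n f))) (monoEL n.+1 (fun z => g z + f z)).
Proof.
move=> xn ex vf; apply: (eqEL_trans _ _ _ (mulEL_eqr x _ _ (Exp_mono n f vf))).
apply/(eqEL_toN _ _ n.+1) => //; first by rewrite /= geq_max xn leqnn.
rewrite toN_mul // ex !(toN_id (monoEL n.+1 _)) /=.
exact: (smul_mono n.+1).
Qed.

Lemma psiEL_eq (x y : EL) : eqEL l x y -> eqEL l (psiEL psi x) (psiEL psi y).
Proof.
have xN := leq_maxl (lev x) (lev y); have yN := leq_maxr (lev x) (lev y).
move=> /(eqEL_toN _ _ _ xN yN) e; apply/(eqEL_toN (psiEL psi x) (psiEL psi y) _ xN yN).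
by rewrite !toN_psi // e.
Qed.

(** * The LE construction *)

Section LE.
Variable H : O -> Prop.
Hypotheses (HH : subgroup O H) (Hnt : exists h, H h /\ h <> gone O)
  (Hgrowth : growth_axiom O l log H)
  (Hsurj : forall y : EL, validEL y -> exists x, validEL x /\ eqEL l (psiEL psi x) y)
  (Hpre : forall (x : EL) h, validEL x -> H h -> eqEL l (psiEL psi x) (embG h) ->
     exists h' (f : O -> k), H h' /\ in_ser O 0%N (fun y => H y /\ glt O (gone O) y) f /\
       eqEL l x (mulEL l (embG h') (ExpEL l log (existT _ 0%N f))))
  (HlH : forall h, H h -> forall y, l h y <> 0 -> exists h', H h' /\ y = psi h').

(** * Closure properties of [k((S))] *)

Lemma in_ser_sub n (S S' : C n -> Prop) (a : C n -> k) :
  (forall x, S x -> S' x) -> in_ser O n S a -> in_ser O n S' a.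
Proof. by move=> h [va Sa]; split=> // y /Sa /h. Qed.

Lemma in_ser0 n (S : C n -> Prop) : in_ser O n S (fun _ => 0).
Proof. by split=> //; apply: svalid0. Qed.

Lemma in_ser_add n (S : C n -> Prop) (a b : C n -> k) :
  in_ser O n S a -> in_ser O n S b -> in_ser O n S (fun x => a x + b x).
Proof.
move=> [va Sa] [vb Sb]; split; first exact: (svalid_add (good_level n)).
by move=> y h; case: (add_neq0 _ _ h) => [/Sa|/Sb].
Qed.

Lemma in_ser_opp n (S : C n -> Prop) (a : C n -> k) :
  in_ser O n S a -> in_ser O n S (fun x => - a x).
Proof.
move=> [va Sa]; split; first exact: (svalid_opp (good_level n)).
by move=> y h; apply: Sa => e; apply: h; rewrite e oppr0.
Qed.

Lemma in_ser_restr n (S P : C n -> Prop) (a : C n -> k) :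
  in_ser O n S a -> in_ser O n (fun x => S x /\ P x) (restr P a).
Proof.
move=> [va Sa]; split; first exact: (svalid_restr (good_level n)).
by move=> y h; have [Py /Sa] := restr_neq0 _ _ _ h.
Qed.

Lemma in_ser_smul n (S : C n -> Prop) (a b : C n -> k) : @sgrp k (lv n) S ->
  in_ser O n S a -> in_ser O n S b -> in_ser O n S (smul (lv n) a b).
Proof.
move=> [_ [SM _]] [va Sa] [vb Sb]; split; first exact: (svalid_smul (good_level n)).
by move=> z /smul_neq0 [x [y [/Sa Sx [/Sb Sy ->]]]]; apply: SM.
Qed.

Lemma in_ser_sone n (S : C n -> Prop) : @sgrp k (lv n) S -> in_ser O n S (sone (lv n)).
Proof.
move=> [S1 _]; split; first exact: (svalid_sone (good_level n)).
by move=> y h; rewrite (sone_neq0 _ h).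
Qed.

Lemma in_ser_sinv n (S : C n -> Prop) (a : C n -> k) : @sgrp k (lv n) S ->
  in_ser O n S a -> (exists x, a x <> 0) -> in_ser O n S (sinv (lv n) a).
Proof.
move=> gS [va Sa] /(inverse_exists (good_level n) a va) [b [vb [ab bS]]].
by rewrite (sinv_eq (good_level n) a b) //; split=> //; apply: bS.
Qed.

Lemma in_ser_push n n' (f : C n -> C n') (S : C n -> Prop) (S' : C n' -> Prop) (a : C n -> k) :
  lemb (lv n) (lv n') f -> (forall x, S x -> S' (f x)) ->
  in_ser O n S a -> in_ser O n' S' (push f a).
Proof.
move=> F SS' [va Sa]; split.
  exact/(svalid_push f (good_level n) (good_level n') F).
by move=> y /push_neq0 [x [-> /Sa /SS']].
Qed.

Lemma in_ser_pull n n' (f : C n -> C n') (S' : C n' -> Prop) (b : C n' -> k) :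
  lemb (lv n) (lv n') f -> (forall y, S' y -> exists x, y = f x) ->
  in_ser O n' S' b -> exists a, b = push f a /\ in_ser O n (fun x => S' (f x)) a.
Proof.
move=> F im [vb Sb]; exists (fun x => b (f x)).
have e : b = push f (fun x => b (f x)).
  by apply: push_eq => [||y /Sb /im] //; apply: lemb_inj F.
split=> //; split; last by move=> y /Sb.
by apply/(svalid_push f (good_level n) (good_level n') F); rewrite -e.
Qed.

Lemma push_gt1_lemb n n' (f : C n -> C n') x : lemb (lv n) (lv n') f ->
  ltl (lv n) (onel (lv n)) x -> ltl (lv n') (onel (lv n')) (f x).
Proof.
by move=> F /(lemb_lt F); rewrite (lemb_one f (good_level n) (good_level n') F).
Qed.

(* [G^n_m] as [l(G^{n-1}_m) + k((G^{n-1}_m)^{>1})]: unlike in [Gpair], the exponents are only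
   required to be supported above 1, which makes monotonicity in [m] an easy induction. *)
Fixpoint Gfull (m n : nat) : C n -> Prop :=
  match n return C n -> Prop with
  | 0%N => fun x => exists h, H h /\ x = iter m psi h
  | n'.+1 => fun x => exists g f, Gfull m n' g /\
      in_ser O n' (fun y => Gfull m n' y /\ ltl (lv n') (onel (lv n')) y) f /\
      x = (fun z => io n' g z + f z)
  end.

(** * Subgroup, shift and monotonicity properties of [Gfull] *)

Lemma Gfull_valid m n x : Gfull m n x -> validl (lv n) x.
Proof.
elim: n x => [//|n IH] x [g [f [/IH vg [[vf f1] ->]]]].
apply: (good_vM _ (good_level n.+1) (io n g) f); first exact/(lemb_valid (lemb_iota n)).
by split=> // y /f1 [].
Qed.

Lemma iota_one n : io n (onel (lv n)) = fun _ => 0.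
Proof. exact: (lemb_one (io n) (good_level n) (good_level n.+1) (lemb_iota n)). Qed.

Lemma iota_mul n x y : io n (mull (lv n) x y) = fun z => io n x z + io n y z.
Proof. exact: (lemb_mul (lemb_iota n)). Qed.

Lemma iota_gi n (G : good (lv n)) x : io n (gi G x) = fun z => - io n x z.
Proof.
apply: functional_extensionality => z; apply/eqP; rewrite -addr_eq0 addrC; apply/eqP.
by have := iota_mul n x (gi G x); rewrite mulgi iota_one => /(f_equal (fun f => f z)) <-.
Qed.

Lemma lemb_iter_psi m : lemb (lv 0) (lv 0) (iter m psi).
Proof.
have F := lemb_psis 0; elim: m => [|m IH]; first by split.
split=> [x y /= e|x y /=|x y /= h|//].
- by apply: (lemb_inj IH); apply: (lemb_inj F).
- by rewrite (lemb_mul IH); apply: (lemb_mul F).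
exact/(lemb_lt F)/(lemb_lt IH).
Qed.

Lemma l_iter_psi m h : l (iter m psi h) = push (iter m psi) (l h).
Proof.
elim: m => [|m IHm]; first by apply: push_eq => // y _; exists y.
case: Hpsi => _ [_ psi_l]; rewrite iterS -psi_l IHm push_push //.
  exact: (lemb_inj (lemb_iter_psi m)).
exact: (psis_inj 0).
Qed.

Lemma sgrp_Gfull m n : @sgrp k (lv n) (Gfull m n).
Proof.
have G0 := good_level 0.
elim: n => [|n [R1 [RM RV]]].
  have F := lemb_iter_psi m; case: HH => [H1 [HM HV]]; split; last split.
  - by exists (gone O); split=> //; apply/esym; apply: (lemb_one _ G0 G0 F).
  - by move=> x y [h [Hh ->]] [h' [Hh' ->]]; exists (gmul O h h'); split;
      [exact: HM|rewrite -(lemb_mul F)].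
  move=> x y e [h [Hh ex]]; have [h' [Hh' e']] := HV _ Hh; exists h'; split=> //.
  apply: (mulg_inj G0 x); rewrite e ex -(lemb_mul F) /= e'.
  by apply/esym; apply: (lemb_one _ G0 G0 F).
split; last split.
- exists (onel (lv n)), (fun _ => 0); split=> //; split; first exact: in_ser0.
  by rewrite iota_one; apply: functional_extensionality => z; rewrite addr0.
- move=> x y [g [f [Rg [Sf ->]]]] [g' [f' [Rg' [Sf' ->]]]].
  exists (mull (lv n) g g'), (fun z => f z + f' z); split; first exact: RM.
  split; first exact: in_ser_add.
  by rewrite iota_mul; apply: functional_extensionality => z /=; rewrite addrACA.
move=> x y e [g [f [Rg [Sf ex]]]].
exists (gi (good_level n) g), (fun z => - f z); split; first exact: RV (mulgi _ g) Rg.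
split; first exact: in_ser_opp.
rewrite iota_gi; apply: functional_extensionality => z.
have := f_equal (fun u => u z) e => /= /eqP; rewrite ex addrC addr_eq0 => /eqP ->.
by rewrite opprD.
Qed.

Lemma Gfull_iota m n x : Gfull m n x -> Gfull m n.+1 (io n x).
Proof.
move=> Rx; exists x, (fun _ => 0); split=> //; split; first exact: in_ser0.
by apply: functional_extensionality => z; rewrite addr0.
Qed.

Lemma Gfull_psi m n x : Gfull m n x -> Gfull m.+1 n (psis O psi n x).
Proof.
elim: n x => [|n IH] x; first by move=> [h [Hh ->]]; exists h.
move=> [g [f [Rg [Sf ->]]]]; exists (psis O psi n g), (push (psis O psi n) f).
split; first exact: IH.
split; last by rewrite -psis_iota /= push_add //; apply: psis_inj.
apply: in_ser_push Sf; first exact: lemb_psis.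
by move=> y [/IH Ry y1]; split=> //; apply: push_gt1_lemb y1; apply: lemb_psis.
Qed.

(** A preimage of [h] under [psi^EL] has the form [h' . Exp f] with [h'] in [H]. Applying [psi^EL]
    gives [h = psi(h') . Exp psi(f)], an equality of monomials at level 1. *)
Lemma Gfull_base h : H h -> Gfull 1 1 (l h).
Proof.
move=> Hh; have G0 := good_level 0; have vh : validEL (embG h : EL) by apply: (svalid_mono G0).
have [x [vx ex]] := Hsurj _ vh.
have [h' [f [Hh' [Sf e]]]] := Hpre x h vx Hh ex.
have vf : validl (lv 1) f by case: Sf => vf f1; split=> // y /f1 [].
have eh N : toN l 1 (embG N : EL) = mono (l N).
  rewrite toN_S // (toN_id (embG N)) push_mono //; exact: (iota_inj 0).
have e1 := mono_mul_Exp 0 (embG h') (l h') f isT (eh h') vf.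
have {e1 e} : eqEL l (psiEL psi (monoEL 1 (fun z => l h' z + f z))) (embG h).
  apply: eqEL_trans ex; apply: eqEL_sym; exact: psiEL_eq (eqEL_trans _ _ _ e e1).
move=> /(eqEL_toN (psiEL psi (monoEL 1 _)) (embG h) 1 isT isT).
rewrite toN_psi // (toN_id (monoEL 1 _)) eh push_mono; last exact: psis_inj.
move=> em; rewrite -(mono_inj _ _ em).
exists (psi h'), (push psi f); split; first by exists h'.
have pI := psis_inj 0.
split; last by rewrite /= push_add //; case: Hpsi => _ [_ <-].
apply: (in_ser_push 0 0 psi) Sf; first exact: (lemb_psis 0).
move=> y [Hy y1]; split; first by exists y.
exact: (push_gt1_lemb 0 0 psi y (lemb_psis 0)).
Qed.

Lemma Gfull_up m n x : Gfull m n x -> Gfull m.+1 n.+1 (io n x).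
Proof.
elim: n x => [|n IH] x.
  move=> [h [Hh ->]]; elim: m => [|m IHm]; first exact: Gfull_base.
  (* Apply [psi] to the statement for [psi^(m)(h)]: it commutes with the embedding and raises the
     lower index by one. *)
  by rewrite iterS -(psis_iota 0); apply: Gfull_psi.
move=> [g [f [Rg [Sf ->]]]]; exists (io n g), (push (io n) f); split; first exact: IH.
split; last by rewrite /= push_add //; apply: iota_inj.
apply: in_ser_push Sf; first exact: lemb_iota.
by move=> y [/IH Ry y1]; split=> //; apply: push_gt1_lemb y1; apply: lemb_iota.
Qed.

(** The index [m] grows for two reasons. At level 0, [l(psi^(m)(h)) = psi^(m)(l(h))] is supported in
    [psi^(m+1)(H)]; higher up, the logarithm of [e(f)] is [f] itself, whose support in [G^n_m]
    embeds in [G^{n+1}_{m+1}]. *)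
Lemma Gfull_log m n v : Gfull m n v -> in_ser O n (Gfull m.+1 n) (io n v).
Proof.
elim: n v => [|n IH] v Rv.
  split; first exact: (iota_ser 0 v I).1.
  case: Rv => [h [Hh ->]] y.
  rewrite (l_iter_psi m h : io 0 (iter m psi h) = _).
  move=> /push_neq0 [x [-> /(HlH _ Hh) [h' [Hh' ->]]]].
  by exists h'; rewrite iterSr.
case: Rv => [g [f [Rg [Sf ->]]]].
rewrite /= push_add; last exact: iota_inj.
apply: in_ser_add.
  apply: in_ser_push (IH _ Rg); first exact: lemb_iota.
  by move=> x; apply: Gfull_iota.
apply: in_ser_push Sf; first exact: lemb_iota.
by move=> x [/Gfull_up].
Qed.

(** * Comparison of [Gnm] with [Gfull] by the growth axiom *)

Local Notation Gn m n := (Gnm O l log psi H m n).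
Local Notation Gp m n := ((Gpair O l log psi H m n).1).

(** The product defining [G^{n+1}_m] becomes a sum of exponents. That 1 belongs to the lower group
    puts the support of [f] above 1, so that [e(f)] is a valid element. *)
Lemma Gnm_S m n x : Gp m n (onel (lv n)) ->
  Gn m n.+1 x <-> exists g f, Gn m n g /\
    in_ser O n (fun y => Gn m n y /\ forall z, Gp m n z -> ltl (lv n) z y) f /\
    x = (fun z => io n g z + f z).
Proof.
move=> P1.
have key g f : in_ser O n (fun y => Gn m n y /\ forall z, Gp m n z -> ltl (lv n) z y) f ->
  eqEL l (monoEL n.+1 x) (mulEL l (monoEL n.+1 (io n g)) (ExpEL l log (mk n f))) <->
  x = (fun z => io n g z + f z).
  move=> [vf f1]; have vf' : validl (lv n.+1) f by split=> // y /f1 [_]; apply.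
  have e := mono_mul_Exp n (monoEL n.+1 (io n g)) (io n g) f (leqnn _)
    (toN_id (monoEL n.+1 (io n g))) vf'.
  split=> [ex|->]; last exact: eqEL_sym e.
  have := eqEL_trans _ _ _ ex e.
  move=> /(eqEL_toN (monoEL n.+1 x) (monoEL n.+1 _) n.+1 (leqnn _) (leqnn _)).
  by rewrite !(toN_id (monoEL n.+1 _)) => em; apply: mono_inj em.
by split=> [[g [f [Qg [Sf /(key _ _ Sf) e]]]]|[g [f [Qg [Sf /(key _ _ Sf) e]]]]];
  exists g, f.
Qed.

Lemma Gnm_one m n : Gp m n (onel (lv n)) /\ Gn m n (onel (lv n)).
Proof.
elim: n => [|n [P1 Q1]]; first by split=> //; apply: (sgrp_Gfull m 0).1.
split; first by exists (onel (lv n)); rewrite iota_one.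
apply/Gnm_S => //; exists (onel (lv n)), (fun _ => 0); split=> //.
split; first exact: in_ser0.
by rewrite iota_one; apply: functional_extensionality => z; rewrite addr0.
Qed.

Lemma ser_pos_pull n n' (f : C n -> C n') (a : C n -> k) : lemb (lv n) (lv n') f ->
  svalid (lv n) a -> ser_pos (ltl (lv n')) (push f a) -> ser_pos (ltl (lv n)) a.
Proof.
move=> F va [u [u0 lu]]; have fI := lemb_inj F.
have /push_neq0 [m [em am]] : push f a u <> 0 by apply/eqP; rewrite gt_eqF.
exists m; rewrite -(push_at f fI a m) -em; split=> // z az.
have := lu (f z); rewrite push_at // em => /(_ az) [/fI|h]; [by left|right].
apply/(lemb_lt_iff f (good_level n) (good_level n') F) => //; exact: va.2.
Qed.

Lemma growth_pos h (f : O -> k) : H h ->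
  in_ser O 0%N (fun y => H y /\ glt O (gone O) y) f -> ser_pos (glt O) f ->
  ser_lt (glt O) (l h) f.
Proof.
move=> Hh Sf pf.
have ex : exists y, f y <> 0 by case: pf => y [y0 _]; exists y; apply/eqP; rewrite gt_eqF.
have := Hgrowth h f Hh Sf ex.
have pe : posEL l (mk 0%N f) by apply/posEL_lead/(@ser_pos_lead k (lv 0)).
have -> : absEL l (mk 0%N f) = mk 0%N f.
  by rewrite /absEL; case: excluded_middle_informative => [p|np] //; case: (np pe).
rewrite /ltEL.
have -> : maxn (lev (LogEL l log (embG h))) (lev (mk 0%N f)) = 0%N by [].
rewrite (toN_id (mk 0%N f)) (toN_id (LogEL l log (embG h))).
by rewrite /LogEL /= (slog_mono (good_level 0) (io 0) log Hlog h I).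
Qed.

(** [psi^(m)] preserves and reflects the order and commutes with [l], so the growth axiom passes
    from [H] to [psi^(m)(H)]. *)
Lemma growth_iter m g (f : O -> k) : Gfull m 0 g ->
  in_ser O 0%N (fun y => Gfull m 0 y /\ glt O (gone O) y) f -> ser_pos (glt O) f ->
  ser_lt (glt O) (l g) f.
Proof.
move=> [h [Hh ->]] Sf pf; have F := lemb_iter_psi m; have G0 := good_level 0.
have [|f0 [ef [vf Sf0]]] := in_ser_pull 0 0 (iter m psi) _ f F _ Sf.
  by move=> y [[h' [_ ->]] _]; exists h'.
rewrite ef l_iter_psi /ser_lt -push_sub; last exact: lemb_inj F.
apply: (ser_pos_push _ F _ (growth_pos h f0 Hh _ _)).
  split=> // y /Sf0 [[h' [Hh' /(lemb_inj F) ->]] h1]; split=> //.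
  apply/(lemb_lt_iff _ G0 G0 F) => //.
  by rewrite (lemb_one _ G0 G0 F).
by apply: (ser_pos_pull 0 0 (iter m psi) f0 F vf); rewrite -ef.
Qed.

Lemma Gfull_gt1 m : exists q, Gfull m 0 q /\ glt O (gone O) q.
Proof.
have G0 := good_level 0; have F := lemb_iter_psi m; case: HH => [_ [_ HV]].
have [h [Hh h1]] : exists h, H h /\ glt O (gone O) h.
  have [h [Hh n1]] := Hnt; have [h' [Hh' e']] := HV h Hh.
  case: (good_total _ G0 (gone O) h I I) => [|[e|lh]]; [by exists h|by case: n1|].
  exists h'; split=> //; have := good_ltM _ G0 _ _ h' lh => /=.
  by rewrite e'; have -> : gmul O (gone O) h' = h' by exact: (good_mul1 _ G0).
exists (iter m psi h); split; first by exists h.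
exact: (push_gt1_lemb 0 0 (iter m psi) h F).
Qed.

(** For some [q > 1] in the group, growth applied to [g] and to its inverse gives [l(g) < q] and
    [-l(g) < q]. Hence the leading exponent [v] of [l(g)] cannot exceed [q]. *)
Lemma l_bound m g y : Gfull m 0 g -> l g y <> 0 -> exists q, Gfull m 0 q /\ @leg k (lv 0) y q.
Proof.
move=> Rg gy; have G0 := good_level 0; have [q [Rq q1]] := Gfull_gt1 m.
have Sq : in_ser O 0%N (fun y => Gfull m 0 y /\ glt O (gone O) y) (mono q).
  by split; [exact: (svalid_mono G0)|move=> z h; rewrite (mono_neq0 _ _ h)].
have pq : ser_pos (glt O) (mono q : O -> k).
  by exists q; rewrite mono_same; split=> // z h; left; apply: mono_neq0 h.
have [_ [_ RV]] := sgrp_Gfull m 0.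
have h1 := growth_iter m g _ Rg Sq pq.
have h2 := growth_iter m _ _ (RV _ _ (mulgi G0 g) Rg) Sq pq.
have vg := (iota_ser 0 g I).1.
have [v [gv glv]] := lead_exists G0 (l g) vg (ex_intro _ y gy).
exists q; split=> //; apply: (leg_trans G0) (glv _ gy) _ => //.
apply: (nlt_leg G0) => // qv.
have qv0 : mono q v = 0 :> k by apply: mono_diff => e; rewrite e in qv; exact: (good_irr _ G0 _ qv).
(* As [v] is assumed to exceed [q] and bounds the support of [l g], it is the leading exponent of
   [d]. For [d = q + l(g)] and [d = q - l(g)] this makes both [l g v] and its opposite positive. *)
have key (d : O -> k) : ser_pos (glt O) d -> d v <> 0 ->
    (forall z, d z <> 0 -> z = q \/ l g z <> 0) -> 0 < d v.
  move=> [u [u0 lu]] dv dz; have du : d u <> 0 by apply/eqP; rewrite gt_eqF.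
  suff -> : v = u by [].
  case: (lu _ dv) => // vu; exfalso.
  case: (dz _ du) => [e|/glv]; last by move/(leg_nlt G0 v u I I).
  by rewrite e in vu; apply: (leg_nlt G0 v q I I) vu; right.
have e2 : l (gi G0 g) = (fun z => - l g z) := iota_gi 0 G0 g.
have : 0 < mono q v - l g v.
  apply: (key (fun z => mono q z - l g z)) => [//||z /add_neq0 [h|h]].
  - by rewrite qv0 sub0r => /eqP; rewrite oppr_eq0 => /eqP.
  - by left; apply: mono_neq0 h.
  by right=> e; apply: h; rewrite e oppr0.
have : 0 < mono q v + l g v.
  apply: (key (fun z => mono q z + l g z)) => [||z /add_neq0 [h|h]]; last by right.
  - have := h2; rewrite e2 /ser_lt; congr ser_pos; apply: functional_extensionality => z.
    by rewrite opprK.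
  - by rewrite qv0 add0r.
  by left; apply: mono_neq0 h.
by rewrite qv0 add0r sub0r oppr_gt0 => /lt_trans h /h; rewrite ltxx.
Qed.

Lemma Gfull_S_bound m n g z :
  (forall g y, Gfull m n g -> io n g y <> 0 -> exists q, Gfull m n q /\ leg y q) ->
  Gfull m n.+1 g -> g z <> 0 -> exists q, Gfull m n q /\ leg z q.
Proof.
move=> bd [g0 [f0 [Rg0 [[_ Sf0] ->]]]] /add_neq0 [/(bd _ _ Rg0) //|/Sf0 [Rz _]].
by exists z; split=> //; left.
Qed.

Lemma leg_iota n x y : leg x y -> leg (io n x) (io n y).
Proof. by move=> [->|/(lemb_lt (lemb_iota n))]; [left|right]. Qed.

(** Consequently a monomial above the image of all of [G^n_m] dominates every logarithm of an
    element of [G^{n+1}_m]. *)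
Lemma iota_bound m n g y : Gfull m n g -> io n g y <> 0 -> exists q, Gfull m n q /\ leg y q.
Proof.
elim: n g y => [|n IH] g y Rg; first exact: l_bound.
move=> /push_neq0 [z [-> gz]].
have [q [Rq zq]] := Gfull_S_bound m n g z IH Rg gz.
by exists (io n q); split; [exact: Gfull_iota|exact: leg_iota].
Qed.

(* The four clauses are carried together through the induction: the growth axiom starts the last
   one, which at [n] gives the third at [n + 1]; that one allows an exponent supported above 1
   to be split as in [Gpair], and the second absorbs the part supported in [G^{n-1}_m]. *)
Lemma Gnm_Gfull_inv m n :
  (forall x, Gn m n x <-> Gfull m n x) /\
  (forall g f, Gfull m n g ->
     in_ser O n (fun y => Gp m n y /\ ltl (lv n) (onel (lv n)) y) f ->
     exists g', Gfull m n g' /\ io n g' = (fun z => io n g z + f z)) /\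
  (forall x, Gfull m n x -> ltl (lv n) (onel (lv n)) x ->
     (forall z, Gp m n z -> ltl (lv n) z x) \/ Gp m n x) /\
  (forall g f, Gfull m n g ->
     in_ser O n (fun y => Gfull m n y /\ forall z, Gp m n z -> ltl (lv n) z y) f ->
     ser_pos (ltl (lv n)) f -> ser_pos (ltl (lv n)) (fun z => f z - io n g z)).
Proof.
elim: n => [|n [QR [A [D E]]]].
  split=> //; split; last split.
  (* At level 0 the lower group is trivial, so an exponent supported in it and above 1 is 0. *)
  - move=> g f Rg [_ Sf]; exists g; split=> //.
    apply: functional_extensionality => z.
    have -> : f z = 0; last by rewrite addr0.
    apply: NNPP => /Sf [-> h]; exact: (good_irr _ (good_level 0) _ h).
  - by move=> x _ x1; left=> z ->.
  move=> g f Rg Sf; apply: (growth_iter m g f Rg).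
  by apply: in_ser_sub Sf => y [Ry hy]; split=> //; apply: hy.
have gn := good_level n; have gn' := good_level n.+1; have F := lemb_iota n.
have ioI := iota_inj n.
have P1 := (Gnm_one m n).1.
have [_ [RM RV]] := sgrp_Gfull m n.
have QR' x : Gn m n.+1 x <-> Gfull m n.+1 x.
  rewrite Gnm_S //; split=> [[g [f [/QR Rg [Sf ->]]]]|[g [f [Rg [Sf ->]]]]].
    exists g, f; split=> //; split=> //.
    by apply: in_ser_sub Sf => y [/QR Ry hy]; split=> //; apply: hy.
  pose big y := forall z, Gp m n z -> ltl (lv n) z y.
  pose f1 := restr big f; pose f2 := restr (fun y => ~ big y) f.
  have Sf1 : in_ser O n (fun y => Gn m n y /\ big y) f1.
    by apply: in_ser_sub (in_ser_restr n _ big f Sf) => y [[/QR]].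
  have Sf2 : in_ser O n (fun y => Gp m n y /\ ltl (lv n) (onel (lv n)) y) f2.
    apply: in_ser_sub (in_ser_restr n _ (fun y => ~ big y) f Sf) => y [[Ry y1] nb].
    by split=> //; case: (D y Ry y1).
  (* By the third clause at [n] the part [f2] is supported in the lower group, so [g . e(f2)] is an
     element [g'] of [G^n_m], and [f1] is left as an admissible exponent. *)
  have [g' [Rg' e']] := A g f2 Rg Sf2.
  exists g', f1; split; first exact/QR.
  split=> //; rewrite e'; apply: functional_extensionality => z.
  rewrite -addrA; congr (_ + _); rewrite /f1 /f2.
  case: (classic (big z)) => bz; first by rewrite restrF ?restrT ?add0r //; auto.
  by rewrite restrT // restrF // addr0.
split=> //; split; last split.
- move=> g f [g0 [f0 [Rg0 [Sf0 eg]]]] Sf.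
  (* The lower group at [n.+1] is the image of [G^n_m], so [f] comes from a series [f'] one level
     down, which can be added to the exponent [f0]. *)
  have [|f' [ef Sf']] := in_ser_pull n n.+1 (io n) _ f F _ Sf.
    by move=> y [[x [_ ->]] _]; exists x.
  exists (fun z => io n g0 z + (f0 z + f' z)); split.
    exists g0, (fun z => f0 z + f' z); split=> //; split=> //.
    apply: in_ser_add => //; split; first exact: Sf'.1.
    move=> y fy; have [[x [/QR Rx /ioI ->]] h1] := Sf'.2 y fy; split=> //.
    apply/(lemb_lt_iff (io n) gn gn' F); [exact: good_v1|exact: Gfull_valid Rx|].
    by rewrite (lemb_one (io n) gn gn' F).
  rewrite ef eg /= -push_add //; congr push.
  by apply: functional_extensionality => z; rewrite addrA.
- move=> x Rx x1; have vx := Gfull_valid _ _ _ Rx.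
  have /(Gnm_S _ _ _ P1) [g [f [/QR Rg [Sf ex]]]] : Gn m n.+1 x by apply/QR'.
  have {}Sf : in_ser O n (fun y => Gfull m n y /\ forall z, Gp m n z -> ltl (lv n) z y) f.
    by apply: in_ser_sub Sf => y [/QR].
  (* The sign of the exponent decides. If [f > 0], the last clause for [g' g^-1] gives [g' < x] for
     every [g']; if [f = 0], then [x] is the image of [g]; and [f < 0] would give [x < 1]. *)
  case: (ser_pos_total gn f Sf.1) => [pf|[f0|nf]].
  + left=> _ [g' [/QR Rg' ->]]; rewrite ex.
    have Rd : Gfull m n (mull (lv n) g' (gi gn g)).
      by apply: RM => //; apply: RV (mulgi gn g) Rg.
    have := E _ _ Rd Sf pf; rewrite iota_mul iota_gi /=.
    rewrite /ser_lt; congr ser_pos; apply: functional_extensionality => z.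
    by rewrite opprD opprK addrA addrAC (addrC (f z)).
  + right; exists g; split; first exact/QR.
    by rewrite ex f0; apply: functional_extensionality => z; rewrite addr0.
  exfalso; have := E _ _ Rg (in_ser_opp n _ f Sf) nf => nx.
  apply: (leg_nlt gn' _ _ vx (good_v1 _ gn')); first by right; exact: x1.
  move: nx; rewrite /= /ser_lt ex; congr ser_pos; apply: functional_extensionality => z.
  by rewrite sub0r opprD addrC.
move=> g f Rg Sf [u [u0 lu]].
have fu : f u <> 0 by apply/eqP; rewrite gt_eqF.
have [Ru bu] := Sf.2 u fu; have vu := Gfull_valid _ _ _ Ru.
(* The leading exponent [u] of [f] exceeds the image of [G^n_m], hence the whole support of the
   logarithm of [g]; so [u] also leads the difference. *)
have lt_u y : io n.+1 g y <> 0 -> ltl (lv n.+1) y u.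
  move=> /push_neq0 [z [-> gz]].
  have vz : validl (lv n) z by apply: (Gfull_valid _ _ _ Rg).1.2.
  have [q [Rq zq]] := Gfull_S_bound m n g z (iota_bound m n) Rg gz.
  have lq : ltl (lv n.+1) (io n q) u by apply: bu; exists q; split=> //; apply/QR.
  apply: (leg_ltW gn' _ (io n q)) (leg_iota n _ _ zq) lq => //.
    exact/(lemb_valid F).
  exact/(lemb_valid F)/(Gfull_valid _ _ _ Rq).
exists u; split.
  have -> : io n.+1 g u = 0; last by rewrite subr0.
  by apply: NNPP => /lt_u /(good_irr _ gn').
move=> z /add_neq0 [/lu //|h]; right; apply: lt_u => e; apply: h; by rewrite e oppr0.
Qed.

Lemma Gnm_Gfull m n x : Gn m n x <-> Gfull m n x.
Proof. exact: (Gnm_Gfull_inv m n).1. Qed.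

(** * Closure properties of the union of the [L_m] *)

Definition inG m N (x : EL) := (lev x <= N)%N /\ in_ser O N (Gfull m N) (toN l N x).

Lemma inG_up m N N' x : (N <= N')%N -> inG m N x -> inG m N' x.
Proof.
move=> NN' [xN Sx]; split; first exact: leq_trans NN'.
elim: N' NN' => [|N' IH]; rewrite leq_eqVlt => /orP[/eqP <- //|] //.
rewrite ltnS => NN'; rewrite toN_S; last exact: leq_trans NN'.
apply: in_ser_push (IH NN'); [exact: lemb_iota|exact: Gfull_iota].
Qed.

Lemma inG_succ m N x : inG m N x -> inG m.+1 N.+1 x.
Proof.
move=> [xN Sx]; split; first exact: ltnW.
by rewrite toN_S //; apply: in_ser_push Sx; [exact: lemb_iota|exact: Gfull_up].
Qed.

Lemma inL_inG m x : inL O l log psi H m x <-> exists N, inG m N x.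
Proof.
split=> [[n [a [Sa e]]]|[N [xN Sx]]].
  have ga : inG m n (mk n a).
    split=> //; rewrite (toN_id (mk n a)).
    by apply: in_ser_sub Sa => y /Gnm_Gfull.
  have xN := leq_maxl (lev x) n; have nN := leq_maxr (lev x) n.
  exists (maxn (lev x) n); split=> //.
  rewrite ((eqEL_toN x (mk n a) _ xN nN).1 e).
  exact: (inG_up m n _ _ nN ga).2.
exists N, (toN l N x); split; first by apply: in_ser_sub Sx => y /Gnm_Gfull.
by apply/(eqEL_toN x (mk N _) N xN (leqnn N)); rewrite (toN_id (mk N _)).
Qed.

Lemma inL_succ m x : inL O l log psi H m x -> inL O l log psi H m.+1 x.
Proof. by move=> /inL_inG [N h]; apply/inL_inG; exists N.+1; apply: inG_succ. Qed.

Lemma inL_mono m m' x : (m <= m')%N -> inL O l log psi H m x -> inL O l log psi H m' x.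
Proof.
move=> h; rewrite -(subnKC h); elim: (m' - m)%N => [|d IH]; first by rewrite addn0.
by rewrite addnS => /IH /inL_succ.
Qed.

Local Notation LE := (inLE O l log psi H).

Lemma inLE_common x y : LE x -> LE y -> exists m N, inG m N x /\ inG m N y.
Proof.
move=> [m hx] [m' hy]; exists (maxn m m').
have /inL_inG [N hN] := inL_mono _ _ _ (leq_maxl m m') hx.
have /inL_inG [N' hN'] := inL_mono _ _ _ (leq_maxr m m') hy.
exists (maxn N N'); split; apply: inG_up; [exact: leq_maxl|exact: hN|exact: leq_maxr|exact: hN'].
Qed.

Lemma inLE_inG x : LE x -> exists m N, inG m N x.
Proof. by move=> [m /inL_inG [N h]]; exists m, N. Qed.

Lemma inG_inLE m N x : inG m N x -> LE x.
Proof. by move=> h; exists m; apply/inL_inG; exists N. Qed.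

Lemma inG_valid m N x : inG m N x -> validEL x.
Proof. by move=> [xN [vx _]]; apply/(toN_valid x N xN). Qed.

Lemma inLE_subfield : subfieldEL l LE.
Proof.
split; first by move=> x /inLE_inG [m [N /inG_valid]]; left.
split; first by apply: (inG_inLE 0 0); split=> //; rewrite toN_zero; apply: in_ser0.
split.
  apply: (inG_inLE 0 0); split=> //; rewrite toN_one; apply: in_ser_sone.
  exact: sgrp_Gfull.
split.
  move=> x y /inLE_common h /h [m [N [[xN Sx] [yN Sy]]]]; apply: (inG_inLE m N).
  by split; [rewrite geq_max xN|rewrite toN_add //; apply: in_ser_add].
split.
  move=> x /inLE_inG [m [N [xN Sx]]]; apply: (inG_inLE m N).
  by split=> //; rewrite toN_opp //; apply: in_ser_opp.
split.
  move=> x y /inLE_common h /h [m [N [[xN Sx] [yN Sy]]]]; apply: (inG_inLE m N).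
  split; first by rewrite geq_max xN.
  by rewrite toN_mul //; apply: in_ser_smul => //; apply: sgrp_Gfull.
move=> x /inLE_inG [m [N gx]] nx; apply: (inG_inLE m N).
have vx := inG_valid _ _ _ gx; have [xN Sx] := gx.
have ex : exists z, projT2 x z <> 0.
  apply: NNPP => h; apply: nx; apply/(eqEL_toN x zeroEL _ (leqnn _) (leq0n _)).
  rewrite toN_id toN_zero; apply: functional_extensionality => z.
  by apply: NNPP => xz; apply: h; exists z.
split=> //; rewrite toN_inv //; apply: in_ser_sinv => //; first exact: sgrp_Gfull.
apply: (toN_ind (fun N a => exists z, a z <> 0)) => // M a [z az].
by exists (io M z); rewrite push_at //; apply: iota_inj.
Qed.

Lemma inLE_base (f : O -> k) : in_ser O 0%N H f -> LE (mk 0%N f).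
Proof.
move=> Sf; apply: (inG_inLE 0 0); split=> //; rewrite (toN_id (mk 0%N f)).
by apply: in_ser_sub Sf => h Hh; exists h.
Qed.

Lemma inLE_psi x : LE x -> LE (psiEL psi x).
Proof.
move=> /inLE_inG [m [N [xN Sx]]]; apply: (inG_inLE m.+1 N); split=> //.
rewrite toN_psi //; apply: in_ser_push Sx; [exact: lemb_psis|exact: Gfull_psi].
Qed.

Lemma inLE_eq x y : eqEL l x y -> LE y -> LE x.
Proof.
move=> e [m [n [a [Sa ey]]]]; exists m, n, a; split=> //; exact: eqEL_trans ey.
Qed.

(** The part [v] of [x] above 1 is, as an exponent, an element [e(v)] of [G^{N+1}_m]. Once [x] is
    embedded at level [N.+1], its part above 1 is the logarithm of this element, so the exponential
    exists there. *)
Lemma inLE_Exp x : LE x -> LE (ExpEL l log x).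
Proof.
move=> /inLE_inG [m [N [xN Sx]]].
have gN := good_level N; have gN' := good_level N.+1; have F := lemb_iota N.
set a := toN l N x in Sx.
pose v := restr (ltl (lv N) (onel (lv N))) a.
have Rv : Gfull m N.+1 v.
  exists (onel (lv N)), v; split; first exact: (sgrp_Gfull m N).1.
  split; first exact: in_ser_restr.
  by rewrite iota_one; apply: functional_extensionality => z; rewrite add0r.
have Sa' : in_ser O N.+1 (Gfull m N.+1) (push (io N) a).
  by apply: in_ser_push Sx => //; apply: Gfull_iota.
have ev : io N.+1 v = restr (ltl (lv N.+1) (onel (lv N.+1))) (push (io N) a).
  apply: push_restr; first exact: iota_inj.
  move=> z az; rewrite -(lemb_one (io N) gN gN' F).
  apply: (lemb_lt_iff (io N) gN gN' F); [exact: good_v1|exact: Sx.1.2].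
have [y [vy [ly [y0 [ey yQ]]]]] :=
  slog_surj gN' (io N.+1) log Hlog _ v Sa'.1 (Gfull_valid _ _ _ Rv) ev.
apply: (inLE_eq _ (mk N.+1 y)).
  apply: ExpEL_eq => //; first by apply/posEL_lead; exists v.
  apply/(eqEL_toN (LogEL l log (mk N.+1 y)) x N.+1 (leqnn _) (leqW xN)).
  by rewrite (toN_id (LogEL l log (mk N.+1 y))) toN_S.
apply: (inG_inLE m N.+1); split=> //; rewrite (toN_id (mk N.+1 y)); split=> //.
by apply: yQ => //; [exact: sgrp_Gfull|exact: Sa'.2].
Qed.

Lemma inLE_Log x : LE x -> posEL l x -> LE (LogEL l log x).
Proof.
move=> /inLE_inG [m [N gx]] /posEL_lead [v0 [lx0 x0]].
have vx := inG_valid _ _ _ gx; have [xN Sx] := gx.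
have [v [lv v1]] := lead_toN x v0 lx0 x0 N xN.
have gN := good_level N; have Rv := Sx.2 _ lv.1.
have [R1 [RM RV]] := sgrp_Gfull m N.
apply: (inG_inLE m.+1 N.+1); split; first exact: leqW.
rewrite toN_S // toN_Log //; last by exists v0.
rewrite (slogE gN (io N) log _ v Sx.1 lv); set e := seps _ v.
have ie : inft e := inft_seps gN _ v Sx.1 lv.
have Re z : e z <> 0 -> Gfull m N z.
  move=> /add_neq0 [/mul_neq0 [_ /Sx.2 h]|h].
    by rewrite -(mulgiK gN v z); apply: RM => //; apply: RV (mulgi gN v) Rv.
  by rewrite (sone_neq0 z) // => e0; apply: h; rewrite e0 oppr0.
(* [l(v)] is supported in [G^N_{m+1}], the other two summands in [G^N_m]. Neither inclusion between
   these is available at level [N], but one level up both lie in [G^{N+1}_{m+1}]. *)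
pose S z := Gfull m N z \/ Gfull m.+1 N z.
apply: (in_ser_push N N.+1 (io N) S); first exact: lemb_iota.
  by move=> z [/Gfull_up|/Gfull_iota].
apply: in_ser_add; first apply: in_ser_add.
- by apply: in_ser_sub (Gfull_log m N v Rv) => z; right.
- split; first by apply: (svalid_sub gN _ _ (svalid_sone gN)) => z /mul_neq0 [].
  by move=> z /mul_neq0 [_ h]; left; rewrite (sone_neq0 z h).
split; first exact: (inft_slogsum gN e ie).1.
move=> z /slogsum_monoid [w [ow ->]]; left.
exact: (sgrp_prodl (Gfull m N) (fun x => e x <> 0)).
Qed.
End LE.
End Tower.

Theorem theorem9 (k : realFieldType) (log : k -> k) (O : ogroup) (l : O -> O -> k)
  (psi : O -> O) (H : O -> Prop) :
  ordered_abelian_group O ->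
  surjective_log log ->
  prelog_section O l ->
  lmorphism O l psi ->
  subgroup O H -> (exists h, H h /\ h <> gone O) ->
  growth_axiom O l log H ->
  (* psi^{EL} surjective *)
  (forall y : EL k O, validEL y -> exists x, validEL x /\ eqEL l (psiEL psi x) y) ->
  (* (psi^{EL})^{-1}(H) <= H . Exp k((H^{>1})) *)
  (forall (x : EL k O) h, validEL x -> H h -> eqEL l (psiEL psi x) (embG h) ->
     exists h' (f : O -> k), H h' /\ in_ser O 0%N (fun y => H y /\ glt O (gone O) y) f /\
       eqEL l x (mulEL l (embG h') (ExpEL l log (existT _ 0%N f)))) ->
  (* l(H) <= k((psi(H))) *)
  (forall h, H h -> forall y, l h y <> 0 -> exists h', H h' /\ y = psi h') ->
  (forall m (x : EL k O), inL O l log psi H m x -> inL O l log psi H m.+1 x) /\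
  subfieldEL l (inLE O l log psi H) /\
  (forall f : O -> k, in_ser O 0%N H f -> inLE O l log psi H (existT _ 0%N f)) /\
  (forall x, inLE O l log psi H x -> inLE O l log psi H (ExpEL l log x)) /\
  (forall x, inLE O l log psi H x -> posEL l x -> inLE O l log psi H (LogEL l log x)) /\
  (forall x, inLE O l log psi H x -> inLE O l log psi H (psiEL psi x)).
Proof.
move=> HO Hlog Hl Hpsi HH Hnt Hgrowth Hsurj Hpre HlH.
split; first by move=> m x; apply: inL_succ.
split; first exact: inLE_subfield.
split; first by move=> f; apply: inLE_base.
split; first by move=> x; apply: inLE_Exp.
split; first by move=> x; apply: inLE_Log.
by move=> x; apply: inLE_psi.
Qed.
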